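(* Let $\mathfrak g=\mathfrak{sl}_{n+1},\ \mathfrak{so}_{2n+1},\ \mathfrak{so}_{2n}$ or $\mathfrak{sp}_{2n}$ and assume that $rs^{-1}$ is not a root of unity. For any module $M$ in the category $\mathcal O$, the operator $\Omega\omega:M\to M$ (the composition of the linear operator $\omega$ followed by the quantum Casimir element $\Omega$, both defined in the context) commutes with the action of $U_{r,s}(\mathfrak g)$ on $M$.
   Context: **The algebra.** $\mathbb K$ is an algebraically closed field containing $\mathbb Q(r,s)$, where $r,s$ are nonzero complex numbers with $r^2\ne s^2$. $\mathfrak g$ is $\mathfrak{sl}_{n+1}$ (type $A$), $\mathfrak{so}_{2n+1}$ ($B$), $\mathfrak{sp}_{2n}$ ($C$) or $\mathfrak{so}_{2n}$ ($D$), simple of rank $n$. Let $\epsilon_1,\epsilon_2,\dots$ ($n+1$ of them in type $A$, $n$ otherwise) be orthonormal for $(\,,)$. Simple roots: $\alpha_i=\epsilon_i-\epsilon_{i+1}$ for $i<n$ (and for $i=n$ in type $A$), and $\alpha_n=\epsilon_n$ ($B$), $2\epsilon_n$ ($C$), $\epsilon_{n-1}+\epsilon_n$ ($D$). Put $\alpha_i^\vee=2\alpha_i/(\alpha_i,\alpha_i)$, $a_{ij}=(\alpha_i^\vee,\alpha_j)$. Put $r_i=r^{(\alpha_i,\alpha_i)}$, $s_i=s^{(\alpha_i,\alpha_i)}$ in type $B$, and $r_i=r^{(\alpha_i,\alpha_i)/2}$, $s_i=s^{(\alpha_i,\alpha_i)/2}$ in types $A,C,D$. Scalars $\langle\omega_i',\omega_j\rangle$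 ($1\le i,j\le n$): - $A$: $r^{(\epsilon_j,\alpha_i)}s^{(\epsilon_{j+1},\alpha_i)}$. - $B$: $r^{2(\epsilon_j,\alpha_i)}s^{2(\epsilon_{j+1},\alpha_i)}$ if $j<n$; $r^{2(\epsilon_n,\alpha_i)}$ if $i<n,j=n$; $rs^{-1}$ if $i=j=n$. - $C$: $r^{(\epsilon_j,\alpha_i)}s^{(\epsilon_{j+1},\alpha_i)}$ if $j<n$; $r^{2(\epsilon_n,\alpha_i)}$ if $i<n,j=n$; $r^{2}s^{-2}$ if $i=j=n$. - $D$: $r^{(\epsilon_j,\alpha_i)}s^{(\epsilon_{j+1},\alpha_i)}$ if $j<n$; $r^{(\epsilon_{n-1},\alpha_i)}s^{-(\epsilon_n,\alpha_i)}$ if $i\ne n-1,j=n$; $r^{-1}s^{-1}$ if $i=n-1,j=n$. $U=U_{r,s}(\mathfrak g)$ is the unital associative $\mathbb K$-algebra generated by $e_i,f_i,\omega_i^{\pm1},\omega_i'^{\pm1}$ ($1\le i\le n$) with relations: all $\omega_i^{\pm1},\omega_j'^{\pm1}$ commute, $\omega_i\omega_i^{-1}=1=\omega_i'\omega_i'^{-1}$; $\omega_je_i\omega_j^{-1}=\langle\omega_i',\omega_j\rangle e_i$, $\omega_jf_i\omega_j^{-1}=\langle\omega_i',\omega_j\rangle^{-1}f_i$, $\omega_j'e_i\omega_j'^{-1}=\langle\omega_j',\omega_i\rangle^{-1}e_i$, $\omega_j'f_i\omega_j'^{-1}=\langle\omega_j',\omega_i\rangle f_i$; $[e_i,f_j]=\delta_{ij}\frac{\omega_i-\omega_i'}{r_i-s_i}$;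 and for $i\ne j$, $(\mathrm{ad}_l e_i)^{1-a_{ij}}(e_j)=0$, $(\mathrm{ad}_r f_i)^{1-a_{ij}}(f_j)=0$, where $\mathrm{ad}_l a(b)=\sum a_{(1)}bS(a_{(2)})$, $\mathrm{ad}_r a(b)=\sum S(a_{(1)})ba_{(2)}$. It is a Hopf algebra: $\omega_i,\omega_i'$ are group-like, $\Delta(e_i)=e_i\otimes1+\omega_i\otimes e_i$, $\Delta(f_i)=1\otimes f_i+f_i\otimes\omega_i'$, $\varepsilon(e_i)=\varepsilon(f_i)=0$, $S(e_i)=-\omega_i^{-1}e_i$, $S(f_i)=-f_i\omega_i'^{-1}$. **Powers and weights.** Fix group homomorphisms $a\mapsto r^a$, $a\mapsto s^a$ from $\mathbb Q$ to $\mathbb K^\times$ with $r^1=r,s^1=s$; put $(rs^{-1})^a=r^as^{-a}$. Writing $\langle\omega_i',\omega_j\rangle=r^{x_{ij}}s^{y_{ij}}$, with $x_{ij},y_{ij}$ the integer exponents of $r$ and $s$ in the formula for the scalar $\langle\omega_i',\omega_j\rangle$ for the type of $\mathfrak g$, for $\zeta=\sum\zeta_i\alpha_i$, $\eta=\sum\eta_j\alpha_j$ with rational coefficients put $\langle\omega_\zeta',\omega_\eta\rangle=r^{\sum x_{ij}\zeta_i\eta_j}s^{\sum y_{ij}\zeta_i\eta_j}$, with $\omega_i=\omega_{\alpha_i}$, $\omega'_i=\omega'_{\alpha_i}$. $\Lambda=\{\lambda\in\bigoplus\mathbb Q\alpha_i:(\lambda,\alpha_i^\vee)\in\mathbb Z\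 \forall i\}$; $Q^+=\sum_i\mathbb Z_{\ge0}\alpha_i$. For a $U$-module $M$ and $\lambda\in\Lambda$, $M_\lambda=\{m:\omega_im=\langle\omega_\lambda',\omega_i\rangle m,\ \omega_i'm=\langle\omega_i',\omega_\lambda\rangle^{-1}m\ \forall i\}$. $\mathcal O$ is the category of $U$-modules $M=\bigoplus_{\lambda\in\Lambda}M_\lambda$ with all $\dim M_\lambda<\infty$ and with $\{\lambda:M_\lambda\neq0\}\subseteq\bigcup_{\mu\in F}(\mu-Q^+)$ for some finite $F\subset\Lambda$. **Pairing and $\Omega$.** Let $\mathcal B$ (resp. $\mathcal B'$) be the Hopf subalgebra generated by all $e_j,\omega_j^{\pm1}$ (resp. $f_j,\omega_j'^{\pm1}$). There is a unique bilinear form $\langle\,,\rangle:\mathcal B'\times\mathcal B\to\mathbb K$ with $\langle f,1\rangle=\varepsilon(f)$, $\langle1,a\rangle=\varepsilon(a)$, $\langle f,a_1a_2\rangle=\langle\Delta^{op}(f),a_1\otimes a_2\rangle$, $\langle f_1f_2,a\rangle=\langle f_1\otimes f_2,\Delta(a)\rangle$, $\langle f_i,e_j\rangle=\delta_{ij}/(s_i-r_i)$, $\langle\omega_i',\omega_j\rangle$ equal to (in type $A$) $r^{(\epsilon_j,\alpha_i)}s^{(\epsilon_{j+1},\alpha_i)}$; (in type $B$) $r^{2(\epsilon_j,\alpha_i)}s^{2(\epsilon_{j+1},\alpha_i)}$ if $j<n$, $r^{2(\epsilon_n,\alpha_i)}$ if $i<n,j=n$, $rs^{-1}$ if $i=j=n$;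 (in type $C$) $r^{(\epsilon_j,\alpha_i)}s^{(\epsilon_{j+1},\alpha_i)}$ if $j<n$, $r^{2(\epsilon_n,\alpha_i)}$ if $i<n,j=n$, $r^{2}s^{-2}$ if $i=j=n$; (in type $D$) $r^{(\epsilon_j,\alpha_i)}s^{(\epsilon_{j+1},\alpha_i)}$ if $j<n$, $r^{(\epsilon_{n-1},\alpha_i)}s^{-(\epsilon_n,\alpha_i)}$ if $i\ne n-1,j=n$, $r^{-1}s^{-1}$ if $i=n-1,j=n$; and $\langle{\omega_i'}^{\pm1},\omega_j^{-1}\rangle=\langle{\omega_i'}^{\pm1},\omega_j\rangle^{-1}=\langle\omega_i',\omega_j\rangle^{\mp1}$, all other pairings of generators being $0$. For $\zeta\in Q^+$ let $U^{\zeta}(\mathfrak n)$ (resp. $U^{-\zeta}(\mathfrak n^-)$) be the degree $\zeta$ (resp. $-\zeta$) component of the subalgebra generated by the $e_i$ (resp. $f_i$), where $\deg e_i=\alpha_i$, $\deg f_i=-\alpha_i$. These two finite-dimensional spaces are nondegenerately paired by $\langle\,,\rangle$; let $\{u_k^\zeta\}$ be a basis of $U^\zeta(\mathfrak n)$ and $\{v_k^\zeta\}$ the dual basis of $U^{-\zeta}(\mathfrak n^-)$, $\langle v_j^\zeta,u_k^\zeta\rangle=\delta_{jk}$. The quantum Casimir element is $\Omega=\sum_{\zeta\in Q^+}\Omega_\zeta$, $\Omega_\zeta=\sum_kS(v_k^\zeta)u_k^\zeta$, acting on modules in $\mathcal O$ (on each vector only finitely many terms are nonzero). **The operator $\omega$.**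 For $M$ in $\mathcal O$, $\omega:M\to M$ is the linear operator with $\omega.v_\mu=(rs^{-1})^{\frac{\Delta_{X,B}}{2}(\mu+\rho,\mu+\rho)}v_\mu$ for $v_\mu\in M_\mu$, where $\rho$ is the half-sum of the positive roots of $\mathfrak g$ and $\Delta_{X,B}=2$ if $\mathfrak g$ is of type $B$, $\Delta_{X,B}=1$ otherwise. *)

(* Defs.v *)
From HB Require Import structures.
From mathcomp Require Import all_boot all_order all_algebra.
From mathcomp Require Import finmap boolp classical_sets fsbigop.
From mathcomp.multinomials Require Import monalg.

Set Implicit Arguments.
Unset Strict Implicit.
Unset Printing Implicit Defensive.

Import Order.TTheory GRing.Theory Num.Theory.
Local Open Scope ring_scope.
Local Open Scope quotient_scope.

(* The Lie algebras sl_(n+1), so_(2n+1), sp_(2n), so_(2n). Simple roots and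
   the vectors epsilon_k are numbered from 0: the simple root with index
   i : 'I_n is the usual alpha_(i+1), and eps k is the usual epsilon_(k+1). *)
Variant lie_type := TypeA | TypeB | TypeC | TypeD.

(* so_2 is abelian and so_4 is not simple *)
Definition is_simple (X : lie_type) (n : nat) : bool :=
  if X is TypeD then (2 < n)%N else (0 < n)%N.

Definition eps_dim (X : lie_type) (n : nat) : nat :=
  if X is TypeA then n.+1 else n.

Definition dot (R : pzRingType) (N : nat) (u v : 'rV[R]_N) : R :=
  \sum_k u 0 k * v 0 k.

Section RootData.
Variables (X : lie_type) (n : nat).
Local Notation N := (eps_dim X n).

Definition eps (k : nat) : 'rV[int]_N := \row_l ((l : nat) == k)%:R.

Definition simple_root (i : 'I_n) : 'rV[int]_N :=
  if (i.+1 < n)%N then eps i - eps i.+1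
  else match X with
       | TypeA => eps i - eps i.+1
       | TypeB => eps i
       | TypeC => 2 *: eps i
       | TypeD => eps i.-1 + eps i
       end.

(* the quotient is exact *)
Definition cartan (i j : 'I_n) : int :=
  ((2 * dot (simple_root i) (simple_root j))
     %/ dot (simple_root i) (simple_root i))%Z.

(* r_i = r ^ root_exp i and s_i = s ^ root_exp i; the quotient is exact, since
   squared root lengths are even in types A, C and D *)
Definition root_exp (i : 'I_n) : int :=
  if X is TypeB then dot (simple_root i) (simple_root i)
  else (dot (simple_root i) (simple_root i) %/ 2)%Z.

(* <omega'_i, omega_j> = r ^ (br_exp i j).1 * s ^ (br_exp i j).2 *)
Definition br_exp (i j : 'I_n) : int * int :=
  let e k := dot (eps k) (simple_root i) in
  let jn := (j.+1 == n)%N in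
  match X with
  | TypeA => (e j, e j.+1)
  | TypeB => if ~~ jn then (2 * e j, 2 * e j.+1)
             else if i != j then (2 * e j, 0) else (1, -1)
  | TypeC => if ~~ jn then (e j, e j.+1)
             else if i != j then (2 * e j, 0) else (2, -2)
  | TypeD => if ~~ jn then (e j, e j.+1)
             else if (i.+1 : nat) != j then (e j.-1, - e j) else (-1, -1)
  end.

(* Elements of the rational span of the simple roots are given by their
   coordinates in the basis of simple roots; weight_vec is the vector in
   epsilon-coordinates. *)
Definition simple_rootQ (i : 'I_n) : 'rV[rat]_N :=
  map_mx intr (simple_root i).

Definition weight_vec (l : 'rV[rat]_n) : 'rV[rat]_N :=
  \sum_i l 0 i *: simple_rootQ i.

Definition corootQ (i : 'I_n) : 'rV[rat]_N :=
  (2 / dot (simple_rootQ i) (simple_rootQ i)) *: simple_rootQ i.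

Definition in_Lambda (l : 'rV[rat]_n) : Prop :=
  forall i, dot (weight_vec l) (corootQ i) \is a Num.int.

Definition pos_roots : seq 'rV[int]_N :=
  let minus := [seq eps k - eps l | k <- iota 0 N, l <- iota k.+1 (N - k.+1)] in
  let plus := [seq eps k + eps l | k <- iota 0 N, l <- iota k.+1 (N - k.+1)] in
  match X with
  | TypeA => minus
  | TypeB => minus ++ plus ++ [seq eps k | k <- iota 0 N]
  | TypeC => minus ++ plus ++ [seq 2 *: eps k | k <- iota 0 N]
  | TypeD => minus ++ plus
  end.

Definition rho : 'rV[rat]_N :=
  2^-1 *: \sum_(b <- pos_roots) map_mx intr b.

(* Delta_(X,B) * (mu + rho, mu + rho) / 2 *)
Definition omega_exp (mu : 'rV[rat]_n) : rat :=
  (if X is TypeB then 2 else 1) / 2 *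
  dot (weight_vec mu + rho) (weight_vec mu + rho).

(* elements of Q^+, by their coordinates on the simple roots *)
Definition Qplus := {ffun 'I_n -> nat}.

Definition weight_sub (mu : 'rV[rat]_n) (z : Qplus) : 'rV[rat]_n :=
  \row_i (mu 0 i - (z i)%:R).

End RootData.

(* e_i, f_i, omega_i, omega_i^-1, omega'_i, omega'_i^-1 *)
Inductive gen (n : nat) : Type :=
  | Ge of 'I_n | Gf of 'I_n | Gw of 'I_n | Gwi of 'I_n | Gw' of 'I_n
  | Gwi' of 'I_n.

Section GenChoice.
Variable n : nat.

Definition gen_code (g : gen n) : 'I_6 * 'I_n :=
  match g with
  | Ge i => (inord 0, i) | Gf i => (inord 1, i) | Gw i => (inord 2, i)
  | Gwi i => (inord 3, i) | Gw' i => (inord 4, i) | Gwi' i => (inord 5, i)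
  end.

Definition gen_decode (c : 'I_6 * 'I_n) : gen n :=
  match val c.1 with
  | 0 => Ge c.2 | 1 => Gf c.2 | 2 => Gw c.2
  | 3 => Gwi c.2 | 4 => Gw' c.2 | _ => Gwi' c.2
  end.

Lemma gen_codeK : cancel gen_code gen_decode.
Proof. by case=> i; rewrite /gen_decode /= inordK. Qed.

HB.instance Definition _ := Choice.copy (gen n) (can_type gen_codeK).

Definition toral (g : gen n) : bool :=
  match g with Ge _ | Gf _ => false | _ => true end.

(* epsilon of the monomial w *)
Definition counit (R : pzRingType) (w : seq (gen n)) : R :=
  \prod_(g <- w) (toral g)%:R.

(* Sweedler components of Delta, each given by a pair of words *)
Definition coprod_gen (g : gen n) : seq (seq (gen n) * seq (gen n)) :=
  match g with
  | Ge i => [:: ([:: Ge i], [::]); ([:: Gw i], [:: Ge i])]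
  | Gf i => [:: ([::], [:: Gf i]); ([:: Gf i], [:: Gw' i])]
  | _ => [:: ([:: g], [:: g])]
  end.

(* Delta is multiplicative *)
Fixpoint coprod_word (w : seq (gen n)) : seq (seq (gen n) * seq (gen n)) :=
  if w is g :: w' then
    [seq (p.1 ++ q.1, p.2 ++ q.2) | p <- coprod_gen g, q <- coprod_word w']
  else [:: ([::], [::])].

Definition in_Bplus (g : gen n) : bool :=
  match g with Ge _ | Gw _ | Gwi _ => true | _ => false end.
Definition in_Bminus (g : gen n) : bool :=
  match g with Gf _ | Gw' _ | Gwi' _ => true | _ => false end.
Definition is_e (g : gen n) : bool := if g is Ge _ then true else false.
Definition is_f (g : gen n) : bool := if g is Gf _ then true else false.

Definition e_word (z : Qplus n) (w : seq (gen n)) : bool :=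
  all is_e w && [forall i, count_mem (Ge i) w == z i].
Definition f_word (z : Qplus n) (w : seq (gen n)) : bool :=
  all is_f w && [forall i, count_mem (Gf i) w == z i].

End GenChoice.

(* The quotient of a K-algebra A by the two-sided ideal generated by the
   differences x - y, for all pairs (x, y) related by R. *)
Section AlgebraQuotient.
Variables (K : pzRingType) (A : lalgType K) (R : A -> A -> Prop).

Inductive rel_ideal : A -> Prop :=
  | rel_ideal0 : rel_ideal 0
  | rel_idealD (a x y b z : A) of R x y & rel_ideal z :
      rel_ideal (a * (x - y) * b + z).

Lemma rel_ideal_add x y : rel_ideal x -> rel_ideal y -> rel_ideal (x + y).
Proof.
move=> Ix Iy; elim: Ix => [|a x' y' b z Rxy _ IH]; first by rewrite add0r.
by rewrite -addrA; exact: rel_idealD.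
Qed.

Lemma rel_ideal_mull c x : rel_ideal x -> rel_ideal (c * x).
Proof.
elim=> [|a x' y' b z Rxy _ IH]; first by rewrite mulr0; exact: rel_ideal0.
by rewrite mulrDr !mulrA; exact: rel_idealD.
Qed.

Lemma rel_ideal_mulr c x : rel_ideal x -> rel_ideal (x * c).
Proof.
elim=> [|a x' y' b z Rxy _ IH]; first by rewrite mul0r; exact: rel_ideal0.
by rewrite mulrDl -(mulrA _ b); exact: rel_idealD.
Qed.

Lemma rel_ideal_opp x : rel_ideal x -> rel_ideal (- x).
Proof. by rewrite -(mulN1r x); exact: rel_ideal_mull. Qed.

Lemma rel_ideal_scale (c : K) x : rel_ideal x -> rel_ideal (c *: x).
Proof. by move=> Ix; rewrite -(mul1r x) scalerAl; exact: rel_ideal_mull. Qed.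

Lemma rel_ideal_rel x y : R x y -> rel_ideal (x - y).
Proof.
move=> Rxy; have := rel_idealD 1 1 Rxy rel_ideal0.
by rewrite mul1r mulr1 addr0.
Qed.

Definition rel_equiv (x y : A) : bool := `[< rel_ideal (x - y) >].

Lemma rel_equiv_is_equiv : equiv_class_of rel_equiv.
Proof.
split=> [x|x y|y x z].
- by apply/asboolP; rewrite subrr; exact: rel_ideal0.
- by apply/asboolP/asboolP => /rel_ideal_opp; rewrite opprB.
- move=> /asboolP Ixy /asboolP Iyz; apply/asboolP.
  by rewrite -[x](subrK y) -addrA; exact: rel_ideal_add.
Qed.

Canonical rel_equiv_equiv := EquivRelPack rel_equiv_is_equiv.
Canonical rel_equiv_encModRel := defaultEncModRel rel_equiv.

Definition quot_alg : Type := {eq_quot rel_equiv}.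
HB.instance Definition _ := Choice.on quot_alg.
HB.instance Definition _ : EqQuotient A rel_equiv quot_alg :=
  EqQuotient.on quot_alg.

Definition to_quot (x : A) : quot_alg := \pi_quot_alg x.

Lemma to_quotP x y : reflect (rel_ideal (x - y)) (to_quot x == to_quot y).
Proof. by rewrite /to_quot piE; exact: asboolP. Qed.

Lemma to_quot_eq x y : rel_ideal (x - y) -> to_quot x = to_quot y.
Proof. by move=> /to_quotP/eqP. Qed.

Lemma to_quot_repr (x : quot_alg) : to_quot (repr x) = x.
Proof. exact: reprK. Qed.

Lemma repr_to_quot x : rel_ideal (repr (to_quot x) - x).
Proof. by apply/to_quotP; rewrite to_quot_repr. Qed.

Definition quot_add (x y : quot_alg) := to_quot (repr x + repr y).
Definition quot_opp (x : quot_alg) := to_quot (- repr x).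
Definition quot_mul (x y : quot_alg) := to_quot (repr x * repr y).
Definition quot_scale (c : K) (x : quot_alg) := to_quot (c *: repr x).

Lemma quot_addE x y : quot_add (to_quot x) (to_quot y) = to_quot (x + y).
Proof.
apply: to_quot_eq; rewrite opprD addrACA.
by apply: rel_ideal_add; exact: repr_to_quot.
Qed.

Lemma quot_oppE x : quot_opp (to_quot x) = to_quot (- x).
Proof.
by apply: to_quot_eq; rewrite -opprD; apply: rel_ideal_opp; exact: repr_to_quot.
Qed.

Lemma quot_mulE x y : quot_mul (to_quot x) (to_quot y) = to_quot (x * y).
Proof.
apply: to_quot_eq.
rewrite -(subrKA (x * repr (to_quot y))) -mulrBl -mulrBr.
by apply: rel_ideal_add; [apply: rel_ideal_mulr|apply: rel_ideal_mull];
  exact: repr_to_quot.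
Qed.

Lemma quot_scaleE c x : quot_scale c (to_quot x) = to_quot (c *: x).
Proof.
apply: to_quot_eq; rewrite -scalerBr.
by apply: rel_ideal_scale; exact: repr_to_quot.
Qed.

Let qE := (quot_addE, quot_oppE, quot_mulE, quot_scaleE).

Lemma quotW (P : quot_alg -> Prop) : (forall x, P (to_quot x)) -> forall x, P x.
Proof. by move=> PU x; rewrite -(to_quot_repr x). Qed.

Lemma quot_addA : associative quot_add.
Proof. by do 3!elim/quotW=> ?; rewrite !qE addrA. Qed.
Lemma quot_addC : commutative quot_add.
Proof. by do 2!elim/quotW=> ?; rewrite !qE addrC. Qed.
Lemma quot_add0 : left_id (to_quot 0) quot_add.
Proof. by elim/quotW=> ?; rewrite !qE add0r. Qed.
Lemma quot_addN : left_inverse (to_quot 0) quot_opp quot_add.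
Proof. by elim/quotW=> ?; rewrite !qE addNr. Qed.

HB.instance Definition _ :=
  GRing.isZmodule.Build quot_alg quot_addA quot_addC quot_add0 quot_addN.

Lemma quot_mulA : associative quot_mul.
Proof. by do 3!elim/quotW=> ?; rewrite !qE mulrA. Qed.
Lemma quot_mul1l : left_id (to_quot 1) quot_mul.
Proof. by elim/quotW=> ?; rewrite !qE mul1r. Qed.
Lemma quot_mul1r : right_id (to_quot 1) quot_mul.
Proof. by elim/quotW=> ?; rewrite !qE mulr1. Qed.
Lemma quot_mulDl : left_distributive quot_mul quot_add.
Proof. by do 3!elim/quotW=> ?; rewrite !qE mulrDl. Qed.
Lemma quot_mulDr : right_distributive quot_mul quot_add.
Proof. by do 3!elim/quotW=> ?; rewrite !qE mulrDr. Qed.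

HB.instance Definition _ := GRing.Zmodule_isPzRing.Build quot_alg
  quot_mulA quot_mul1l quot_mul1r quot_mulDl quot_mulDr.

Lemma quot_scaleA a b x :
  quot_scale a (quot_scale b x) = quot_scale (a * b) x.
Proof. by elim/quotW: x => x; rewrite !qE scalerA. Qed.
Lemma quot_scale1 : left_id 1 quot_scale.
Proof. by elim/quotW=> x; rewrite !qE scale1r. Qed.
Lemma quot_scaleDr : right_distributive quot_scale quot_add.
Proof. by move=> c; do 2!elim/quotW=> ?; rewrite !qE scalerDr. Qed.
Lemma quot_scaleDl x a b :
  quot_scale (a + b) x = quot_add (quot_scale a x) (quot_scale b x).
Proof. by elim/quotW: x => x; rewrite !qE scalerDl. Qed.

HB.instance Definition _ := GRing.Zmodule_isLmodule.Build K quot_alg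
  quot_scaleA quot_scale1 quot_scaleDr quot_scaleDl.

Lemma quot_scaleAl (c : K) (x y : quot_alg) : c *: (x * y) = c *: x * y.
Proof.
change (quot_scale c (quot_mul x y) = quot_mul (quot_scale c x) y).
by elim/quotW: x; elim/quotW: y => y x; rewrite !qE scalerAl.
Qed.

Lemma quot_scaleAr (scaleAr : forall (c : K) (x y : A), c *: (x * y) = x * (c *: y))
  (c : K) (x y : quot_alg) : c *: (x * y) = x * (c *: y).
Proof.
change (quot_scale c (quot_mul x y) = quot_mul x (quot_scale c y)).
by elim/quotW: x; elim/quotW: y => y x; rewrite !qE scaleAr.
Qed.

End AlgebraQuotient.

Section Relations.
Variables (K : fieldType) (X : lie_type) (n : nat) (r s : K).

Definition br (i j : 'I_n) : K :=
  r ^ (br_exp X i j).1 * s ^ (br_exp X i j).2.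
Definition r_ (i : 'I_n) : K := r ^ root_exp X i.
Definition s_ (i : 'I_n) : K := s ^ root_exp X i.

(* The defining relations, for elements x g of an algebra A; U_(r,s)(g) is
   obtained below from the generators of the free algebra. *)
Variables (A : lalgType K) (x : gen n -> A).

Definition mon (w : seq (gen n)) : A := \prod_(g <- w) x g.

Definition antipode_gen (g : gen n) : A :=
  match g with
  | Ge i => - (x (Gwi i) * x (Ge i))
  | Gf i => - (x (Gf i) * x (Gwi' i))
  | Gw i => x (Gwi i)
  | Gwi i => x (Gw i)
  | Gw' i => x (Gwi' i)
  | Gwi' i => x (Gw' i)
  end.

Definition antipode_word (w : seq (gen n)) : A :=
  \prod_(g <- rev w) antipode_gen g.

(* the adjoint actions of a word w *)
Definition ad_l (w : seq (gen n)) (b : A) : A :=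
  \sum_(p <- coprod_word w) mon p.1 * b * antipode_word p.2.
Definition ad_r (w : seq (gen n)) (b : A) : A :=
  \sum_(p <- coprod_word w) antipode_word p.1 * b * mon p.2.

Inductive Urel : A -> A -> Prop :=
  | rel_toral g h of toral g & toral h : Urel (x g * x h) (x h * x g)
  | rel_winv i : Urel (x (Gw i) * x (Gwi i)) 1
  | rel_w'inv i : Urel (x (Gw' i) * x (Gwi' i)) 1
  | rel_we i j :
      Urel (x (Gw j) * x (Ge i) * x (Gwi j)) (br i j *: x (Ge i))
  | rel_wf i j :
      Urel (x (Gw j) * x (Gf i) * x (Gwi j)) ((br i j)^-1 *: x (Gf i))
  | rel_w'e i j :
      Urel (x (Gw' j) * x (Ge i) * x (Gwi' j)) ((br j i)^-1 *: x (Ge i))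
  | rel_w'f i j :
      Urel (x (Gw' j) * x (Gf i) * x (Gwi' j)) (br j i *: x (Gf i))
  | rel_ef i j :
      Urel (x (Ge i) * x (Gf j) - x (Gf j) * x (Ge i))
           ((i == j)%:R *: ((r_ i - s_ i)^-1 *: (x (Gw i) - x (Gw' i))))
  | rel_serre_e i j of i != j :
      Urel (iter `|1 - cartan X i j|%N (ad_l [:: Ge i]) (x (Ge j))) 0
  | rel_serre_f i j of i != j :
      Urel (iter `|1 - cartan X i j|%N (ad_r [:: Gf i]) (x (Gf j))) 0.

(* An augmentation that vanishes on the e_i and f_i respects the relations, so
   that they do not force 1 = 0. *)
Variable f : {rmorphism A -> K}.
Hypotheses (fZ : forall (c : K) a, f (c *: a) = c * f a)
  (fx : forall g, f (x g) = (toral g)%:R).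

Let fE := (rmorphB, rmorphM, rmorph1, rmorph0, fZ, fx).

Lemma augment_ad_l i m y : f y = 0 -> f (iter m (ad_l [:: Ge i]) y) = 0.
Proof.
move=> y0; elim: m => //= m IH.
rewrite {1}/ad_l /= big_cons big_seq1 rmorphD !rmorphM IH.
by rewrite !(mulr0, mul0r) addr0.
Qed.

Lemma augment_ad_r i m y : f y = 0 -> f (iter m (ad_r [:: Gf i]) y) = 0.
Proof.
move=> y0; elim: m => //= m IH.
rewrite {1}/ad_r /= big_cons big_seq1 rmorphD !rmorphM IH.
by rewrite !(mulr0, mul0r) addr0.
Qed.

Lemma augment_rel y z : Urel y z -> f y = f z.
Proof.
case=> [g h _ _|i|i|i j|i j|i j|i j|i j|i j _|i j _].
- by rewrite !rmorphM mulrC.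
- by rewrite !fE mulr1.
- by rewrite !fE mulr1.
- by rewrite !fE /= !(mulr0n, mulr0, mul0r).
- by rewrite !fE /= !(mulr0n, mulr0, mul0r).
- by rewrite !fE /= !(mulr0n, mulr0, mul0r).
- by rewrite !fE /= !(mulr0n, mulr0, mul0r).
- by rewrite !fE /= !(mulr0n, mulr0, mul0r) !subrr !mulr0.
- by rewrite augment_ad_l ?fE.
- by rewrite augment_ad_r ?fE.
Qed.

Lemma augment_ideal y : rel_ideal Urel y -> f y = 0.
Proof.
elim=> [|a y' z b t Rxy _ IH]; first by rewrite rmorph0.
by rewrite rmorphD !rmorphM rmorphB IH (augment_rel Rxy) subrr mulr0 mul0r addr0.
Qed.

End Relations.

Section Urs.
Variables (K : fieldType) (X : lie_type) (n : nat) (r s : K).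

(* the free algebra on the generators *)
Local Notation freeU := {malg K[{fmonom gen n}]}.

Definition free_gen (g : gen n) : freeU := << FMonom [:: g] >>.

Local Notation UR := (Urel X r s free_gen).

Definition counit_fmonom (w : {fmonom gen n}) : K := counit K w.

Lemma counit_fmonom_morph : mmorphism counit_fmonom.
Proof.
split=> [x y|]; last by rewrite /counit_fmonom /counit fm1 big_nil.
by rewrite /counit_fmonom /counit fmM big_cat.
Qed.
HB.instance Definition _ :=
  isMultiplicative.Build {fmonom gen n} K counit_fmonom counit_fmonom_morph.

Lemma Urs_one_neq0 : (1 : quot_alg UR) != 0.
Proof.
apply/(@to_quotP _ _ UR); rewrite subr0.
move=> /(@augment_ideal _ _ _ _ _ _ _ (mmap idfun counit_fmonom)).
rewrite rmorph1 => H; suff /eqP : 1 = 0 :> K by rewrite oner_eq0.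
apply: H => [c a|g]; first exact: mmapZ.
by rewrite /= /free_gen mmapU /counit_fmonom /counit big_seq1 mul1r.
Qed.

Lemma free_scaleAr (c : K) (x y : freeU) : c *: (x * y) = x * (c *: y).
Proof.
apply/malgP=> k; rewrite mcoeffZ.
rewrite [in RHS](mcoeffMlw _ (fsubset_refl _) (msuppZ_le c y)) mcoeffMl.
rewrite big_distrr /=; apply: eq_bigr => k1 _.
rewrite big_distrr /=; apply: eq_bigr => k2 _.
by rewrite mcoeffZ mulrnAr mulrCA.
Qed.

Definition Urs : Type := quot_alg UR.

HB.instance Definition _ := GRing.Lmodule.on Urs.
HB.instance Definition _ := GRing.PzRing.on Urs.
HB.instance Definition _ := GRing.PzSemiRing_isNonZero.Build Urs Urs_one_neq0.
HB.instance Definition _ :=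
  GRing.Lmodule_isLalgebra.Build K Urs (@quot_scaleAl _ _ UR).
HB.instance Definition _ := GRing.Lalgebra_isAlgebra.Build K Urs
  (quot_scaleAr free_scaleAr).

Definition Ugen (g : gen n) : Urs := to_quot UR (free_gen g).

Definition Umon (w : seq (gen n)) : Urs := mon Ugen w.

(* the K-span of the monomials satisfying P *)
Definition mon_span (P : pred (seq (gen n))) (a : Urs) : Prop :=
  exists2 t : seq (K * seq (gen n)),
    all (fun p => P p.2) t & a = \sum_(p <- t) p.1 *: Umon p.2.

(* The Hopf subalgebras B and B'. The subalgebras generated by the given
   elements are stable under Delta and S. *)
Definition in_B : Urs -> Prop := mon_span (all (@in_Bplus n)).
Definition in_B' : Urs -> Prop := mon_span (all (@in_Bminus n)).

(* U^zeta(n) and U^(-zeta)(n^-) *)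
Definition in_Ue (z : Qplus n) : Urs -> Prop := mon_span (e_word z).
Definition in_Uf (z : Qplus n) : Urs -> Prop := mon_span (f_word z).

Record is_antipode (S : Urs -> Urs) : Prop := {
  antipode_linear : forall (c : K) a b, S (c *: a + b) = c *: S a + S b;
  antipode1 : S 1 = 1;
  antipodeM : forall a b, S (a * b) = S b * S a;
  antipodeE : forall g, S (Ugen g) = antipode_gen Ugen g
}.

Definition pair_gen (g h : gen n) : K :=
  match g, h with
  | Gf i, Ge j => (i == j)%:R / (s_ X s i - r_ X r i)
  | Gw' i, Gw j | Gwi' i, Gwi j => br X r s i j
  | Gw' i, Gwi j | Gwi' i, Gw j => (br X r s i j)^-1
  | _, _ => 0
  end.

(* The pairing of B' and B, as a function whose values outside B' x B are
   irrelevant. The conditions that involve Delta or epsilon are stated on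
   monomials, which span B and B'. In pairingMr the components of Delta are
   exchanged because of Delta^op. *)
Record is_pairing (p : Urs -> Urs -> K) : Prop := {
  pairing_linearl : forall (c : K) f1 f2 a, in_B' f1 -> in_B' f2 -> in_B a ->
    p (c *: f1 + f2) a = c * p f1 a + p f2 a;
  pairing_linearr : forall (c : K) f a1 a2, in_B' f -> in_B a1 -> in_B a2 ->
    p f (c *: a1 + a2) = c * p f a1 + p f a2;
  pairing1r : forall w, all (@in_Bminus n) w -> p (Umon w) 1 = counit K w;
  pairing1l : forall w, all (@in_Bplus n) w -> p 1 (Umon w) = counit K w;
  pairingMr : forall w a1 a2, all (@in_Bminus n) w -> in_B a1 -> in_B a2 ->
    p (Umon w) (a1 * a2) =
    \sum_(c <- coprod_word w) p (Umon c.2) a1 * p (Umon c.1) a2;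
  pairingMl : forall f1 f2 w, in_B' f1 -> in_B' f2 -> all (@in_Bplus n) w ->
    p (f1 * f2) (Umon w) =
    \sum_(c <- coprod_word w) p f1 (Umon c.1) * p f2 (Umon c.2);
  pairing_gen : forall g h, in_Bminus g -> in_Bplus h ->
    p (Ugen g) (Ugen h) = pair_gen g h
}.

Definition is_basis (P : Urs -> Prop) (d : nat) (u : 'I_d -> Urs) : Prop :=
  [/\ forall k, P (u k),
      forall a, P a -> exists c : 'I_d -> K, a = \sum_k c k *: u k
    & forall c : 'I_d -> K, \sum_k c k *: u k = 0 -> forall k, c k = 0].

Definition dual_bases (p : Urs -> Urs -> K) (z : Qplus n) (d : nat)
    (u v : 'I_d -> Urs) : Prop :=
  [/\ is_basis (in_Ue z) u, is_basis (in_Uf z) v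
    & forall j k, p (v j) (u k) = (j == k)%:R].

(* Rational powers: a group homomorphism from rat to the units of K *)
Record rat_power (t : K) (tp : rat -> K) : Prop := {
  rat_powerD : forall a b, tp (a + b) = tp a * tp b;
  rat_power_neq0 : forall a, tp a != 0;
  rat_power1 : tp 1 = t
}.

Section Modules.
(* a |-> r^a and a |-> s^a *)
Variables (rp sp : rat -> K).

Definition brQ (l m : 'rV[rat]_n) : K :=
  rp (\sum_i \sum_j ((br_exp X i j).1)%:~R * l 0 i * m 0 j) *
  sp (\sum_i \sum_j ((br_exp X i j).2)%:~R * l 0 i * m 0 j).

(* K acts on a U-module through K -> U *)
Variable M : lmodType Urs.

Definition in_weight (l : 'rV[rat]_n) (m : M) : Prop :=
  forall i,
    Ugen (Gw i) *: m = (brQ l (delta_mx 0 i))%:A *: m /\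
    Ugen (Gw' i) *: m = ((brQ (delta_mx 0 i) l)^-1)%:A *: m.

Record in_O : Prop := {
  O_sum : forall m : M, exists2 t : seq ('rV[rat]_n * M),
    {in t, forall q, in_Lambda X q.1 /\ in_weight q.1 q.2} &
    m = \sum_(q <- t) q.2;
  O_direct : forall (t : seq 'rV[rat]_n) (f : 'rV[rat]_n -> M),
    uniq t -> {in t, forall l, in_Lambda X l /\ in_weight l (f l)} ->
    \sum_(l <- t) f l = 0 -> {in t, forall l, f l = 0};
  O_fin_dim : forall l, in_Lambda X l -> exists t : seq M,
    forall m, in_weight l m -> exists c : 'I_(size t) -> K,
      m = \sum_(k < size t) (c k)%:A *: t`_k;
  O_bounded : exists2 F : seq 'rV[rat]_n, {in F, forall mu, in_Lambda X mu} &
    forall l, in_Lambda X l -> (exists2 m, in_weight l m & m != 0) ->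
      exists2 mu, mu \in F & exists z : Qplus n, l = weight_sub mu z
}.

Record is_omega (om : M -> M) : Prop := {
  omega_linear : forall (c : K) m1 m2,
    om (c%:A *: m1 + m2) = c%:A *: om m1 + om m2;
  omega_weight : forall mu m, in_Lambda X mu -> in_weight mu m ->
    om m = (rp (omega_exp X mu) * sp (- omega_exp X mu))%:A *: m
}.

(* Omega, for the antipode S and the bases u z and v z in all degrees z. The
   sum over Q^+ is finitely supported for M in O. *)
Definition casimir (S : Urs -> Urs) (d : Qplus n -> nat)
    (u v : forall z, 'I_(d z) -> Urs) (m : M) : M :=
  \sum_(z \in [set: Qplus n]) (\sum_k S (v z k) * u z k) *: m.

End Modules.
End Urs.

(* Main.v *)
Require Import Defs.
From mathcomp Require Import all_boot all_order all_algebra.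
From mathcomp Require Import finmap boolp classical_sets fsbigop.
From mathcomp.multinomials Require Import monalg.
From mathcomp Require Import zify ring lra.
Set Implicit Arguments.
Unset Strict Implicit.
Unset Printing Implicit Defensive.
Import Order.TTheory GRing.Theory Num.Theory.
Local Open Scope ring_scope.

(** Write w_i, w'_i for the two families of toral generators, v_k, u_k for the
    dual bases in degree z, and Omega_z = sum_k S(v_k) u_k. The proof rests on
    two identities in U, one for each simple root a_i,

      w_i^-1 e_i Omega_(z+a_i) = P_(z+a_i) - P_z + w'_i^-1 Omega_z e_i,
      Omega_(z+a_i) f_i        = R_(z+a_i) - R_z + f_i w'_i^-1 Omega_z w_i,

    where P_z = sum_k S(v_k) w_i^-1 e_i u_k and R_z = sum_k S(v_k) f_i u_k
    ([casimir_deg_eS], [casimir_deg_fS]). When they are summed over all degrees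
    the terms P and R telescope, so that on a module in the category O

      e_i Omega = w_i w'_i^-1 Omega e_i,   Omega f_i = f_i w'_i^-1 Omega w_i

    ([casimir_op_e], [casimir_op_f]); moreover Omega commutes with the torus,
    since S(v_k) u_k has degree zero. On the weight space of mu the element
    w_i w'_i^-1 acts by <w'_mu, w_i> <w'_i, w_mu>. The exponents of r and s in
    <w'_i, w_j> <w'_j, w_i> are plus and minus a fixed multiple of (a_i, a_j)
    ([br_exp_sym]), and 2 (rho, a_i) = (a_i, a_i), hence this scalar is the
    quotient of the eigenvalues of omega at mu and mu - a_i ([theta_add]). It
    therefore cancels in Omega omega, which commutes with e_i and f_i.

    The two identities come from the pairing. For y of degree - z - a_i in the
    negative part, the commutator [e_i, y] is a combination of two skew
    derivatives of y ([rgen_word_comm]), and these are the adjoints of left and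
    right multiplication by e_i ([pair_lskew], [pair_rskew]). Expanding in dual
    bases, the structure constants disappear:

      [e_i, y] = (sum_l <y, u_l e_i> v_l) w'_i - w_i (sum_l <y, e_i u_l> v_l)

    ([rgen_deg_comm]). Take y = v_k, apply S, multiply by u_k on the right, and
    sum over k: since sum_k <v_k, a> u_k = a, this is the first identity.

    The second one is the mirror image: exchanging e and f, w and w', and the
    two arguments of the pairing preserves all the relations and the axioms of
    the pairing, except that a coproduct becomes the opposite one. A boolean b,
    the side, thus runs through the first part of the proof: the side b = true
    consists of the e_i and w_i, the side b = false of the f_i and w'_i.

    Apart from the root data, the argument is carried out in an arbitrary algebra
    with elements that satisfy the relations it uses, and in the modules over
    this algebra; U and its pairing enter at the end. *)

(** * Spans of monomials *)

Section Span.
Variables (K : fieldType) (n : nat) (A : algType K) (x : gen n -> A).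

Definition word_span (P : pred (seq (gen n))) (a : A) : Prop :=
  exists2 t : seq (K * seq (gen n)),
    all (fun p => P p.2) t & a = \sum_(p <- t) p.1 *: mon x p.2.

Lemma mon_nil : mon x [::] = 1.
Proof. by rewrite /mon big_nil. Qed.

Lemma mon_cons g w : mon x (g :: w) = x g * mon x w.
Proof. by rewrite /mon big_cons. Qed.

Lemma mon_cat w w' : mon x (w ++ w') = mon x w * mon x w'.
Proof. by rewrite /mon big_cat. Qed.

Lemma mon1 g : mon x [:: g] = x g.
Proof. by rewrite mon_cons mon_nil mulr1. Qed.

Lemma word_span_mon (P : pred (seq (gen n))) w : P w -> word_span P (mon x w).
Proof.
by move=> Pw; exists [:: (1, w)]; rewrite /= ?Pw // big_seq1 scale1r.
Qed.

Lemma word_span_lin (P : pred (seq (gen n))) c (a b : A) :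
  word_span P a -> word_span P b -> word_span P (c *: a + b).
Proof.
move=> [t tP ->] [t' t'P ->].
exists ([seq (c * q.1, q.2) | q <- t] ++ t').
  by rewrite all_cat all_map t'P andbT; apply: sub_all tP => q.
rewrite big_cat big_map scaler_sumr /=; congr (_ + _).
by apply: eq_bigr => q _; rewrite scalerA.
Qed.

Lemma word_span0 (P : pred (seq (gen n))) : word_span P (0 : A).
Proof. by exists [::]; rewrite ?big_nil. Qed.

Lemma word_spanZ (P : pred (seq (gen n))) c (a : A) :
  word_span P a -> word_span P (c *: a).
Proof.
by move=> Pa; rewrite -[_ *: _]addr0; apply: word_span_lin => //; exact: word_span0.
Qed.

Lemma word_spanD (P : pred (seq (gen n))) (a b : A) :
  word_span P a -> word_span P b -> word_span P (a + b).
Proof. by move=> Pa; rewrite -[a]scale1r; exact: word_span_lin. Qed.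

Lemma word_span_ind (P : pred (seq (gen n))) (Q : A -> Prop) :
  Q 0 -> (forall c a b, word_span P a -> Q a -> word_span P b -> Q b ->
    Q (c *: a + b)) ->
  (forall w, P w -> Q (mon x w)) -> forall a, word_span P a -> Q a.
Proof.
move=> Q0 Ql Qw a [t tP ->].
suff [] : word_span P (\sum_(p <- t) p.1 *: mon x p.2) /\
   Q (\sum_(p <- t) p.1 *: mon x p.2) by [].
elim: t tP => [_|q t IH /= /andP[Pq /IH[h1 h2]]].
  by rewrite big_nil; split=> //; exact: word_span0.
rewrite big_cons; split.
  by apply: word_span_lin => //; exact: word_span_mon.
by apply: Ql => //; [exact: word_span_mon|exact: Qw].
Qed.

Lemma word_spanW (P Q : pred (seq (gen n))) (a : A) :
  (forall w, P w -> Q w) -> word_span P a -> word_span Q a.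
Proof.
move=> PQ; elim/word_span_ind => [|c a1 a2 _ h1 _|w /PQ]; first exact: word_span0.
  exact: word_span_lin.
exact: word_span_mon.
Qed.

Lemma word_spanM (P Q R : pred (seq (gen n))) (a b : A) :
  (forall w w', P w -> Q w' -> R (w ++ w')) ->
  word_span P a -> word_span Q b -> word_span R (a * b).
Proof.
move=> PQR Pa Qb; elim/word_span_ind: Pa => [|c a1 a2 _ h1 _ h2|w Pw].
- by rewrite mul0r; exact: word_span0.
- by rewrite mulrDl -scalerAl; exact: word_span_lin.
elim/word_span_ind: Qb => [|c b1 b2 _ h1 _ h2|w' Qw'].
- by rewrite mulr0; exact: word_span0.
- by rewrite mulrDr -scalerAr; exact: word_span_lin.
by rewrite -mon_cat; apply: word_span_mon; exact: PQR.
Qed.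

Lemma word_span_sum (P : pred (seq (gen n))) I (t : seq I) (c : I -> K) (f : I -> A) :
  (forall i, word_span P (f i)) -> word_span P (\sum_(i <- t) c i *: f i).
Proof.
move=> Pf; elim: t => [|i t IH]; first by rewrite big_nil; exact: word_span0.
by rewrite big_cons; exact: word_span_lin.
Qed.

End Span.

(** * The two sides and their coproducts *)

Section Letters.
Variable n : nat.

Definition rgen (b : bool) (i : 'I_n) : gen n := if b then Ge i else Gf i.
Definition tgen (b : bool) (i : 'I_n) : gen n := if b then Gw i else Gw' i.
Definition tinv (b : bool) (i : 'I_n) : gen n := if b then Gwi i else Gwi' i.

Definition letter (b : bool) : pred (gen n) :=
  if b then @in_Bplus n else @in_Bminus n.
Definition is_rgen (b : bool) : pred (gen n) :=
  if b then @is_e n else @is_f n.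
Definition deg_word (b : bool) (z : Qplus n) : pred (seq (gen n)) :=
  if b then e_word z else f_word z.
(** On the side b = false this is the opposite coproduct. With this choice the
    formula for root generators has the same shape on both sides, as does the
    compatibility of the pairing with products. *)
Definition side_coprod (b : bool) (w : seq (gen n)) :=
  if b then coprod_word w else [seq (c.2, c.1) | c <- coprod_word w].

Lemma letter_rgen b i : letter b (rgen b i). Proof. by case: b. Qed.
Lemma letter_tgen b i : letter b (tgen b i). Proof. by case: b. Qed.
Lemma is_rgen_rgen b i : is_rgen b (rgen b i). Proof. by case: b. Qed.
Lemma is_rgenP b g : is_rgen b g -> exists i, g = rgen b i.
Proof. by case: b g => [] [] i //; exists i. Qed.
Lemma sub_is_rgen b w : all (is_rgen b) w -> all (letter b) w.
Proof. by apply: sub_all => g /is_rgenP[i ->]; exact: letter_rgen. Qed.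
Lemma rgen_inj b : injective (rgen b).
Proof. by case: b => i j []. Qed.

Lemma deg_wordE b z w :
  deg_word b z w = all (is_rgen b) w && [forall i, count_mem (rgen b i) w == z i].
Proof. by case: b. Qed.

Lemma deg_word_letter b z w : deg_word b z w -> all (letter b) w.
Proof. by rewrite deg_wordE => /andP[/sub_is_rgen]. Qed.

Lemma is_rgen_map b w : all (is_rgen b) w -> exists w', w = map (rgen b) w'.
Proof.
elim: w => [|g w IH /= /andP[/is_rgenP[i ->] /IH[w' ->]]]; first by exists [::].
by exists (i :: w').
Qed.

Lemma all_letter_map b (w : seq 'I_n) : all (letter b) (map (rgen b) w).
Proof. by elim: w => //= i w ->; rewrite letter_rgen. Qed.

Lemma all_is_rgen_map b (w : seq 'I_n) : all (is_rgen b) (map (rgen b) w).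
Proof. by elim: w => //= i w ->; rewrite is_rgen_rgen. Qed.

Lemma big_side_coprod_cons (V : nmodType) b j w
    (h : seq (gen n) -> seq (gen n) -> V) :
  \sum_(c <- side_coprod b (rgen b j :: w)) h c.1 c.2 =
  \sum_(c <- side_coprod b w) h (rgen b j :: c.1) c.2 +
  \sum_(c <- side_coprod b w) h (tgen b j :: c.1) (rgen b j :: c.2).
Proof.
case: b => /=; first by rewrite big_cat /= big_map cats0 big_map.
by rewrite !big_map cats0 big_cat !big_map.
Qed.

Lemma side_coprod_rgen b j : side_coprod b [:: rgen b j] =
  [:: ([:: rgen b j], [::]); ([:: tgen b j], [:: rgen b j])].
Proof. by case: b. Qed.

Lemma side_coprod_tgen b j :
  side_coprod b [:: tgen b j] = [:: ([:: tgen b j], [:: tgen b j])].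
Proof. by case: b. Qed.

Lemma side_coprod_letters b w c : all (is_rgen b) w -> c \in side_coprod b w ->
  all (letter b) c.1 && all (is_rgen b) c.2.
Proof.
elim: w c => [|g w IH] c; first by case: b => _; rewrite inE => /eqP->.
case/andP=> /is_rgenP[i ->] /IH{}IH.
suff H : forall c, c \in side_coprod b (rgen b i :: w) ->
    exists2 c', c' \in side_coprod b w & c = (rgen b i :: c'.1, c'.2) \/
       c = (tgen b i :: c'.1, rgen b i :: c'.2).
  by move/H => [c' /IH /andP[h1 h2] [->|->]] /=;
    rewrite h1 h2 ?letter_rgen ?letter_tgen ?is_rgen_rgen.
move=> {}c; case: b IH => _ /=.
  rewrite mem_cat => /orP[|]; last rewrite cats0; move=> /mapP[c' cc' ->];
   by exists c' => //; auto.
case/mapP => c'' + ->; rewrite mem_cat => /orP[|]; last rewrite cats0;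
  move=> /mapP[c' cc' ->]; exists (c'.2, c'.1) => /=; auto;
  by apply/mapP; exists c'.
Qed.

Lemma counit_cons (R : pzRingType) g (w : seq (gen n)) :
  counit R (g :: w) = (toral g)%:R * counit R w.
Proof. by rewrite /counit big_cons. Qed.

Lemma counit_nil (R : pzRingType) : counit R ([::] : seq (gen n)) = 1.
Proof. by rewrite /counit big_nil. Qed.

Lemma toral_rgen b i : toral (rgen b i) = false. Proof. by case: b. Qed.
Lemma toral_tgen b i : toral (tgen b i) = true. Proof. by case: b. Qed.

(** The counit axiom, in the form in which functionals are evaluated on it. *)
Lemma side_coprod_counitl (R : pzRingType) b w (h : seq (gen n) -> R) :
  \sum_(c <- side_coprod b (map (rgen b) w)) counit R c.1 * h c.2 =
  h (map (rgen b) w).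
Proof.
elim: w h => [|j w IH] h /=.
  by case: b; rewrite /= big_seq1 counit_nil mul1r.
rewrite (big_side_coprod_cons _ _ _ (fun c1 c2 => counit R c1 * h c2)).
rewrite big1 ?add0r; last first.
  by move=> c _; rewrite counit_cons toral_rgen !mul0r.
rewrite -(IH (fun w => h (rgen b j :: w))); apply: eq_bigr => c _.
by rewrite counit_cons toral_tgen mul1r.
Qed.

Lemma side_coprod_counitr (R : pzRingType) b w (h : seq (gen n) -> R) :
  \sum_(c <- side_coprod b (map (rgen b) w)) h c.1 * counit R c.2 =
  h (map (rgen b) w).
Proof.
elim: w h => [|j w IH] h /=.
  by case: b; rewrite /= big_seq1 counit_nil mulr1.
rewrite (big_side_coprod_cons _ _ _ (fun c1 c2 => h c1 * counit R c2)).
rewrite addrC big1 ?add0r; last first.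
  by move=> c _; rewrite counit_cons toral_rgen mul0r mulr0.
exact: (IH (fun w => h (rgen b j :: w))).
Qed.

End Letters.

(** * Commutators with a root generator are skew derivations *)

Section Sides.
Variables (K : fieldType) (n : nat) (A : algType K) (x : gen n -> A).
Variables (q : 'I_n -> 'I_n -> K) (c : 'I_n -> K).

(** If q i j = <w'_i, w_j>, this is the pairing of the i-th toral generator of
    side b with the j-th one of the other side. *)
Definition side_br (b : bool) (i j : 'I_n) : K := if b then q j i else q i j.

Local Notation G b w := (mon x (map (rgen b) w)).

(** The relations between the generators, in the form that is invariant under
    the exchange of the two sides. *)
Record side_rel : Prop := {
  side_q : forall i j, q i j != 0;
  side_kK : forall b i, x (tgen b i) * x (tinv b i) = 1;
  side_toral : forall g h, toral g -> toral h -> x g * x h = x h * x g;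
  side_kg : forall b i j,
    x (tgen b i) * x (rgen b j) = side_br b i j *: (x (rgen b j) * x (tgen b i));
  side_gk : forall b i j,
    x (rgen b j) * x (tgen (~~ b) i) =
    side_br b j i *: (x (tgen (~~ b) i) * x (rgen b j));
  side_gg : forall b i j,
    x (rgen (~~ b) i) * x (rgen b j) - x (rgen b j) * x (rgen (~~ b) i) =
    (j == i)%:R *: (c i *: (x (tgen (~~ b) i) - x (tgen b i)))
}.

Let H b := word_span x (all (@letter n b)).

(** The pairing seen from both sides: [pi b] takes its first argument in side b
    and its second one in the other side. *)
Record side_pairing (pi : bool -> A -> A -> K) : Prop := {
  pair_sym : forall b a a', pi (~~ b) a a' = pi b a' a;
  pair_lin : forall b k a1 a2 a', H b a1 -> H b a2 -> H (~~ b) a' ->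
    pi b (k *: a1 + a2) a' = k * pi b a1 a' + pi b a2 a';
  pair_1 : forall b w, all (letter b) w -> pi b (mon x w) 1 = counit K w;
  pair_mul : forall b w a1 a2, all (letter b) w -> H (~~ b) a1 -> H (~~ b) a2 ->
    pi b (mon x w) (a1 * a2) =
    \sum_(c <- side_coprod b w) pi b (mon x c.1) a1 * pi b (mon x c.2) a2;
  pair_gg : forall b i j,
    pi b (x (rgen b j)) (x (rgen (~~ b) i)) = - c i * (j == i)%:R;
  pair_gk : forall b i j, pi b (x (rgen b i)) (x (tgen (~~ b) j)) = 0;
  pair_kk : forall b i j, pi b (x (tgen b i)) (x (tgen (~~ b) j)) = side_br b i j
}.

Hypothesis rel : side_rel.

(** The two skew derivatives of a word along the i-th root generator. The order
    of the factors and the twists are arranged so that no scalar is left in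
    [pair_lskew] and [pair_rskew] besides the value of the pairing on the
    generators. *)
Fixpoint lskew b i (w : seq 'I_n) : A :=
  if w is j :: w' then
    (j == i)%:R *: G b w' + side_br b j i *: (x (rgen b j) * lskew b i w')
  else 0.

Fixpoint rskew b i (w : seq 'I_n) : A :=
  if w is j :: w' then
    x (rgen b j) * rskew b i w' +
    (j == i)%:R *: ((\prod_(k <- w') side_br b i k) *: G b w')
  else 0.

Lemma tgen_word b i w :
  x (tgen b i) * G b w = (\prod_(k <- w) side_br b i k) *: (G b w * x (tgen b i)).
Proof.
elim: w => [|j w IH]; first by rewrite mon_nil big_nil mulr1 mul1r scale1r.
rewrite /= mon_cons big_cons mulrA (side_kg rel) -scalerAl -mulrA IH.
by rewrite -scalerAr scalerA mulrA.
Qed.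

Lemma word_tgen b i w :
  G b w * x (tgen (~~ b) i) =
  (\prod_(k <- w) side_br b k i) *: (x (tgen (~~ b) i) * G b w).
Proof.
elim: w => [|j w IH]; first by rewrite mon_nil big_nil mulr1 mul1r scale1r.
rewrite /= mon_cons big_cons -mulrA IH -scalerAr (mulrA (x (rgen b j))).
by rewrite (side_gk rel) -scalerAl scalerA -mulrA (mulrC (side_br _ _ _)).
Qed.

(** By induction on the word, [e_i, f_j w] = [e_i, f_j] w + f_j [e_i, w]; the
    toral elements are collected on the left in one term and on the right in the
    other one, which explains the twists in [lskew] and [rskew]. *)
Lemma rgen_word_comm b i w :
  x (rgen (~~ b) i) * G b w - G b w * x (rgen (~~ b) i) =
  c i *: (x (tgen (~~ b) i) * lskew b i w - rskew b i w * x (tgen b i)).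
Proof.
elim: w => [|j w IH]; first by rewrite mon_nil mulr0 mul0r mulr1 mul1r !subrr scaler0.
set y := x (rgen (~~ b) i) in IH *.
rewrite /= mon_cons mulrA -[y * _](subrK (x (rgen b j) * y)) (side_gg rel).
rewrite mulrDl -addrA -!mulrA -mulrBr IH.
have -> : x (rgen b j) *
    (c i *: (x (tgen (~~ b) i) * lskew b i w - rskew b i w * x (tgen b i)))
  = c i *: (side_br b j i *: (x (tgen (~~ b) i) * (x (rgen b j) * lskew b i w))
       - x (rgen b j) * rskew b i w * x (tgen b i)).
  by rewrite -scalerAr mulrBr !mulrA (side_gk rel) -scalerAl.
rewrite mulrDr mulrDl -!scalerAl -!scalerAr mulrBl tgen_word.
rewrite (scalerA _ (c i)) (mulrC _ (c i)) -scalerA -scalerDr; congr (_ *: _).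
by rewrite opprD scalerBr addrACA (addrC (- (_ *: _))).
Qed.

End Sides.

(** * The skew derivations are adjoint to multiplications *)

Section Adjunction.
Variables (K : fieldType) (n : nat) (A : algType K) (x : gen n -> A).
Variables (q : 'I_n -> 'I_n -> K) (c : 'I_n -> K).
Hypothesis rel : side_rel x q c.
Variable pi : bool -> A -> A -> K.
Hypothesis piP : side_pairing x q c pi.

Local Notation G b w := (mon x (map (rgen b) w)).
Local Notation H b := (word_span x (all (@letter n b))).
Local Notation E b := (word_span x (all (@is_rgen n b))).
Local Notation side_br := (side_br q).
Local Notation lskew := (lskew x q).
Local Notation rskew := (rskew x q).

Lemma hopf_mul b a1 a2 : H b a1 -> H b a2 -> H b (a1 * a2).
Proof. by apply: word_spanM => w w'; rewrite all_cat => -> ->. Qed.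

Lemma hopf_gen b g : letter b g -> H b (x g).
Proof. by move=> bg; rewrite -(mon1 x); apply: word_span_mon; rewrite /= bg. Qed.

Lemma hopf_rgen b i : H b (x (rgen b i)). Proof. exact/hopf_gen/letter_rgen. Qed.
Lemma hopf_tgen b i : H b (x (tgen b i)). Proof. exact/hopf_gen/letter_tgen. Qed.

Lemma hopf_mon b w : all (letter b) w -> H b (mon x w).
Proof. exact: word_span_mon. Qed.

Lemma hopf_word b w : H b (G b w).
Proof. exact/hopf_mon/all_letter_map. Qed.

Lemma hopf_span b a : E b a -> H b a.
Proof. by apply: word_spanW => w; exact: sub_is_rgen. Qed.

Lemma hopf_lskew b i w : H b (lskew b i w).
Proof.
elim: w => [|j w IH] /=; first exact: word_span0.
apply: word_span_lin; first exact: hopf_word.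
by apply: word_spanZ; apply: hopf_mul => //; exact: hopf_rgen.
Qed.

Lemma hopf_rskew b i w : H b (rskew b i w).
Proof.
elim: w => [|j w IH] /=; first exact: word_span0.
apply: word_spanD; first by apply: hopf_mul => //; exact: hopf_rgen.
by apply: word_spanZ; apply: word_spanZ; exact: hopf_word.
Qed.

Lemma pair0 b a : H (~~ b) a -> pi b 0 a = 0.
Proof.
move=> Ha; have := pair_lin piP (-1) (word_span0 _ _) (word_span0 _ _) Ha.
by rewrite scaler0 addr0 mulN1r addNr.
Qed.

Lemma pairZ b k a a' : H b a -> H (~~ b) a' -> pi b (k *: a) a' = k * pi b a a'.
Proof.
move=> Ha Ha'; have := pair_lin piP k Ha (word_span0 _ _) Ha'.
by rewrite addr0 (pair0 Ha') addr0.
Qed.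

Lemma pairD b a1 a2 a' : H b a1 -> H b a2 -> H (~~ b) a' ->
  pi b (a1 + a2) a' = pi b a1 a' + pi b a2 a'.
Proof.
by move=> h1 h2 Ha'; have := pair_lin piP 1 h1 h2 Ha'; rewrite scale1r mul1r.
Qed.

Lemma pair_symN b a a' : pi b a a' = pi (~~ b) a' a.
Proof. exact/esym/(pair_sym piP). Qed.

Lemma pair_mulN b w a1 a2 : all (letter (~~ b)) w -> H b a1 -> H b a2 ->
    pi b (a1 * a2) (mon x w) =
    \sum_(c <- side_coprod (~~ b) w) pi b a1 (mon x c.1) * pi b a2 (mon x c.2).
Proof.
move=> lw h1 h2; rewrite pair_symN (pair_mul piP) ?negbK //.
by apply: eq_bigr => d _; rewrite !(pair_sym piP).
Qed.

Lemma pair_kg b i j : pi b (x (tgen b i)) (x (rgen (~~ b) j)) = 0.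
Proof.
by rewrite pair_symN; have := pair_gk piP (~~ b) j i; rewrite negbK.
Qed.

Lemma pair_mul_rgen b a1 a2 i : H b a1 -> H b a2 ->
  pi b (a1 * a2) (x (rgen (~~ b) i)) =
  pi b a1 (x (rgen (~~ b) i)) * pi b a2 1 +
  pi b a1 (x (tgen (~~ b) i)) * pi b a2 (x (rgen (~~ b) i)).
Proof.
move=> h1 h2; rewrite -(mon1 x (rgen (~~ b) i)) pair_mulN //; last first.
  by rewrite /= letter_rgen.
by rewrite side_coprod_rgen big_cons big_seq1 /= !mon1 mon_nil.
Qed.

Lemma pair_rgen_cons b i j v : all (letter b) v ->
  pi b (mon x (rgen b j :: v)) (x (rgen (~~ b) i)) =
  - c i * (j == i)%:R * counit K v.
Proof.
move=> lv; rewrite mon_cons pair_mul_rgen; [|exact: hopf_rgen|exact: hopf_mon].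
by rewrite (pair_gg piP) (pair_gk piP) (pair_1 piP) // mul0r addr0.
Qed.

Lemma pair_tgen_cons b i j v : all (letter b) v ->
  pi b (mon x (tgen b j :: v)) (x (rgen (~~ b) i)) =
  side_br b j i * pi b (mon x v) (x (rgen (~~ b) i)).
Proof.
move=> lv; rewrite mon_cons pair_mul_rgen; [|exact: hopf_tgen|exact: hopf_mon].
by rewrite pair_kg (pair_kk piP) mul0r add0r.
Qed.

Lemma side_coprod_hopf b w d : d \in side_coprod b (map (rgen b) w) ->
  [/\ all (letter b) d.1, all (letter b) d.2 & all (@is_rgen n b) d.2].
Proof.
move=> /(side_coprod_letters (all_is_rgen_map b w)) /andP[h1 h2].
by split=> //; exact: sub_is_rgen.
Qed.

Lemma pair_1_rgen b i : pi b 1 (x (rgen (~~ b) i)) = 0.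
Proof.
rewrite pair_symN -(mon1 x) (pair_1 piP) /= ?letter_rgen //.
by rewrite counit_cons toral_rgen mul0r.
Qed.

Lemma side_coprod_nil b : side_coprod b [::] =
  [:: ([::], [::])] :> seq (seq (gen n) * seq (gen n)).
Proof. by case: b. Qed.

(** In the coproduct of w only the terms whose first component contains
    exactly one root generator can pair nontrivially with a root generator, and
    their second components add up to the skew derivative. The prefix v in the
    induction carries the letters already read. *)
Lemma pair_lskew b i w a : H (~~ b) a ->
  pi b (G b w) (x (rgen (~~ b) i) * a) = - c i * pi b (lskew b i w) a.
Proof.
move=> Ha; rewrite (pair_mul piP) ?all_letter_map //; last exact: hopf_rgen.
have H1 : H b 1 by rewrite -(mon_nil x); exact: word_span_mon.
suff L v : H b v -> \sum_(d <- side_coprod b (map (rgen b) w))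
    pi b (mon x d.1) (x (rgen (~~ b) i)) * pi b (v * mon x d.2) a =
    - c i * pi b (v * lskew b i w) a.
  rewrite -[lskew b i w]mul1r -(L 1 H1).
  by apply: eq_bigr => d _; rewrite mul1r.
elim: w v => [|j w IH] v Hv /=.
  by rewrite side_coprod_nil big_seq1 mulr0 (pair0 Ha) mulr0 mon_nil pair_1_rgen mul0r.
rewrite (big_side_coprod_cons _ _ _ (fun d1 d2 =>
   pi b (mon x d1) (x (rgen (~~ b) i)) * pi b (v * mon x d2) a)).
rewrite mulrDr -!scalerAr pairD ?mulrA; first last.
- by [].
- apply: word_spanZ; rewrite -mulrA; do 2!(apply: hopf_mul => //).
    exact: hopf_rgen.
  exact: hopf_lskew.
- by apply: word_spanZ; apply: hopf_mul => //; exact: hopf_word.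
rewrite !pairZ //; first last.
- by apply: hopf_mul => //; exact: hopf_word.
- rewrite -mulrA; do 2!(apply: hopf_mul => //); first exact: hopf_rgen.
  exact: hopf_lskew.
rewrite mulrDr; congr (_ + _).
  rewrite mulrA -(side_coprod_counitl b w (fun w => pi b (v * mon x w) a)) mulr_sumr.
  rewrite [LHS]big_seq [RHS]big_seq; apply: eq_bigr => d /side_coprod_hopf[h1 _ _].
  by rewrite pair_rgen_cons // !mulrA.
rewrite mulrCA -IH; last by apply: hopf_mul => //; exact: hopf_rgen.
rewrite mulr_sumr [LHS]big_seq [RHS]big_seq.
apply: eq_bigr => d /side_coprod_hopf[h1 _ _].
by rewrite pair_tgen_cons // mon_cons !mulrA.
Qed.

(** In the coproduct of a product a of root generators, the second components
    are again such products, and these pair to zero with a toral element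
    unless they are empty. Hence toral factors on the right of the other
    argument do not matter, while those on the left would. *)
Lemma pair_mul_tgen b i y a : H b y -> E (~~ b) a ->
  pi b (y * x (tgen b i)) a = pi b y a.
Proof.
move=> Hy; have Hk := hopf_tgen b i.
have Hyk := hopf_mul Hy Hk.
elim/word_span_ind => [|k a1 a2 /hopf_span h1 IH1 /hopf_span h2 IH2|w Ew].
- by rewrite !(pair_symN b) !pair0 // negbK.
- by rewrite !(pair_symN b) !(pair_lin piP) // -?(pair_symN b) ?IH1 ?IH2 ?negbK.
have [w' ->] := is_rgen_map Ew.
rewrite pair_mulN ?all_letter_map //.
rewrite -(side_coprod_counitr (~~ b) w' (fun w => pi b y (mon x w))).
rewrite [LHS]big_seq [RHS]big_seq; apply: eq_bigr => d /side_coprod_hopf[h1 _ h2].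
congr (_ * _); case: d.2 h2 => [|g t] /=.
  move=> _; rewrite mon_nil -(mon1 x (tgen b i)) (pair_1 piP) /= ?letter_tgen //.
  by rewrite counit_cons toral_tgen mul1r.
move=> /andP[/is_rgenP[j ->] /sub_is_rgen lt].
rewrite mon_cons -(mon1 x (tgen b i)) (pair_mul piP) /= ?letter_tgen //; last 2 first.
- exact: hopf_rgen.
- exact: hopf_mon.
by rewrite side_coprod_tgen big_seq1 /= mon1 pair_kg mul0r counit_cons toral_rgen mul0r.
Qed.

(** Same as [pair_lskew], for the second components of the coproduct. Here the
    first components still contain one toral generator. It is moved to the right
    end of the word, where [pair_mul_tgen] removes it. *)
Lemma pair_rskew b i w a : E (~~ b) a ->
  pi b (G b w) (a * x (rgen (~~ b) i)) = - c i * pi b (rskew b i w) a.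
Proof.
move=> Ea; have Ha := hopf_span Ea.
rewrite (pair_mul piP) ?all_letter_map //; last exact: hopf_rgen.
have H1 : H b 1 by rewrite -(mon_nil x); exact: word_span_mon.
suff L v : H b v -> \sum_(d <- side_coprod b (map (rgen b) w))
    pi b (v * mon x d.1) a * pi b (mon x d.2) (x (rgen (~~ b) i)) =
    - c i * pi b (v * rskew b i w) a.
  rewrite -[rskew b i w]mul1r -(L 1 H1).
  by apply: eq_bigr => d _; rewrite mul1r.
elim: w v => [|j w IH] v Hv /=.
  by rewrite side_coprod_nil big_seq1 mulr0 (pair0 Ha) mulr0 mon_nil pair_1_rgen mulr0.
rewrite (big_side_coprod_cons _ _ _ (fun d1 d2 =>
   pi b (v * mon x d1) a * pi b (mon x d2) (x (rgen (~~ b) i)))).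
rewrite mulrDr -!scalerAr pairD ?mulrA; first last.
- by [].
- by do 2!apply: word_spanZ; apply: hopf_mul => //; exact: hopf_word.
- rewrite -mulrA; do 2!(apply: hopf_mul => //); first exact: hopf_rgen.
  exact: hopf_rskew.
have Hw : H b (v * G b w) by apply: hopf_mul => //; exact: hopf_word.
rewrite !pairZ //; last exact: word_spanZ.
rewrite mulrDr -IH; last by apply: hopf_mul => //; exact: hopf_rgen.
congr (_ + _).
  by apply: eq_bigr => d _; rewrite mon_cons mulrA.
transitivity (- c i * (j == i)%:R * pi b (v * mon x (tgen b j :: map (rgen b) w)) a).
  rewrite -(side_coprod_counitr b w
    (fun w => pi b (v * mon x (tgen b j :: w)) a)) mulr_sumr.
  rewrite [LHS]big_seq [RHS]big_seq; apply: eq_bigr => d /side_coprod_hopf[h1 h2 _].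
  by rewrite pair_rgen_cons // mulrCA !mulrA.
rewrite mon_cons (tgen_word rel) -scalerAr (mulrA v) pairZ ?pair_mul_tgen //; last first.
  by apply: hopf_mul => //; exact: hopf_tgen.
by rewrite -!mulrA; case: eqP => [->|_] //; rewrite !mul0r.
Qed.

(** The degree of w minus the i-th simple root, without subtraction: no word
    qualifies when the letter i does not occur in w, and the skew derivatives of
    such a w vanish. *)
Definition deg_minus b i (w : seq 'I_n) : pred (seq (gen n)) := fun v =>
  all (is_rgen b) v && perm_eq (rgen b i :: v) (map (rgen b) w).

Lemma deg_minus_word b j w : word_span x (deg_minus b j (j :: w)) (G b w).
Proof.
by apply: word_span_mon; rewrite /deg_minus all_is_rgen_map perm_refl.
Qed.

Lemma deg_minus_cons b i j w a :
  word_span x (deg_minus b i w) a ->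
  word_span x (deg_minus b i (j :: w)) (x (rgen b j) * a).
Proof.
move=> wa; rewrite -(mon1 x (rgen b j)).
apply: (@word_spanM _ _ _ _ (pred1 [:: rgen b j]) _ _ _ _ _ _ wa); last first.
  by apply: word_span_mon; rewrite /= eqxx.
move=> w' v /eqP-> /andP[h1 h2]; rewrite /deg_minus /= is_rgen_rgen h1 /=.
by rewrite (perm_catCA [:: _] [:: _] v) perm_cons.
Qed.

Lemma lskew_deg b i w : word_span x (deg_minus b i w) (lskew b i w).
Proof.
elim: w => [|j w IH] /=; first exact: word_span0.
apply: word_spanD; last by apply: word_spanZ; exact: deg_minus_cons.
case: eqP => [->|_]; last by rewrite scale0r; exact: word_span0.
by apply: word_spanZ; exact: deg_minus_word.
Qed.

Lemma rskew_deg b i w : word_span x (deg_minus b i w) (rskew b i w).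
Proof.
elim: w => [|j w IH] /=; first exact: word_span0.
apply: word_spanD; first exact: deg_minus_cons.
case: eqP => [->|_]; last by rewrite scale0r; exact: word_span0.
by do 2!apply: word_spanZ; exact: deg_minus_word.
Qed.

Definition deg_add (z : Qplus n) (i : 'I_n) : Qplus n := [ffun j => ((j == i) + z j)%N].

Local Notation Sd b z := (word_span x (deg_word b z)).

Lemma deg_minus_add b i z w a : deg_word b (deg_add z i) (map (rgen b) w) ->
  word_span x (deg_minus b i w) a -> Sd b z a.
Proof.
rewrite deg_wordE => /andP[_ /forallP hw]; apply: word_spanW => v /andP[gv pv].
rewrite deg_wordE gv; apply/forallP => j.
move/permP: pv => /(_ (pred1 (rgen b j))); rewrite (eqP (hw j)) ffunE /=.
by rewrite (inj_eq (@rgen_inj _ b)) eq_sym => /addnI/eqP.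
Qed.

Lemma deg_minus_eq0 b i (z : Qplus n) w a :
  deg_word b z (map (rgen b) w) -> z i = 0%N ->
  word_span x (deg_minus b i w) a -> a = 0.
Proof.
rewrite deg_wordE => /andP[_ /forallP hw] zi.
elim/word_span_ind => [//|k a1 a2 _ -> _ ->|v /andP[_ pv]].
  by rewrite scaler0 addr0.
move/permP: pv => /(_ (pred1 (rgen b i))); rewrite (eqP (hw i)) zi /=.
by rewrite eqxx.
Qed.

Lemma rgen_deg_comm0 b i (z : Qplus n) y : z i = 0%N -> Sd b z y ->
  x (rgen (~~ b) i) * y = y * x (rgen (~~ b) i).
Proof.
move=> zi; elim/word_span_ind => [|k a1 a2 _ h1 _ h2|w sw].
- by rewrite mulr0 mul0r.
- by rewrite mulrDr mulrDl -scalerAr -scalerAl h1 h2.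
move: (sw); rewrite deg_wordE => /andP[/is_rgen_map[w' def_w] _].
apply/eqP; rewrite -subr_eq0 def_w (rgen_word_comm rel).
rewrite def_w in sw.
rewrite (deg_minus_eq0 sw zi (lskew_deg b i w')).
rewrite (deg_minus_eq0 sw zi (rskew_deg b i w')).
by rewrite mulr0 mul0r subrr scaler0.
Qed.

Section DualBases.
Variables (z : Qplus n) (d : nat) (b : bool) (u v : 'I_d -> A).
Hypothesis uS : forall l, Sd (~~ b) z (u l).
Hypothesis vS : forall l, Sd b z (v l).
Hypothesis v_gen : forall a, Sd b z a -> exists k : 'I_d -> K, a = \sum_l k l *: v l.
Hypothesis uv : forall j k, pi b (v j) (u k) = (j == k)%:R.

Lemma deg_hopf b' z' a : Sd b' z' a -> H b' a.
Proof. by apply: word_spanW => w; exact: deg_word_letter. Qed.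

Lemma deg_span b' z' a : Sd b' z' a -> E b' a.
Proof. by apply: word_spanW => w; rewrite deg_wordE => /andP[]. Qed.

Lemma pair_sum I (t : seq I) (k : I -> K) (f : I -> A) a :
  (forall i, H b (f i)) -> H (~~ b) a ->
  pi b (\sum_(i <- t) k i *: f i) a = \sum_(i <- t) k i * pi b (f i) a.
Proof.
move=> Hf Ha; elim: t => [|i t IH]; first by rewrite !big_nil pair0.
rewrite !big_cons (pair_lin piP) ?IH //; exact: word_span_sum.
Qed.

Lemma dual_expand a : Sd b z a -> a = \sum_l pi b a (u l) *: v l.
Proof.
move=> /v_gen[k ->]; apply: eq_bigr => l _; congr (_ *: _).
rewrite pair_sum; [|by move=> i; exact: deg_hopf (vS i)|exact: deg_hopf (uS l)].
rewrite (bigD1 l) //= uv eqxx mulr1 big1 ?addr0 // => j /negPf jl.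
by rewrite uv jl mulr0.
Qed.

(** The skew derivatives in [rgen_word_comm] lie in degree z, so that they can
    be expanded in the dual bases of that degree. By adjunction their
    coefficients are values of the pairing on y, up to the factor - c i, which
    cancels the c i of the commutator. In this form the formula is linear in y,
    although the skew derivatives are only defined on words. *)
Lemma rgen_deg_comm i y : Sd b (deg_add z i) y ->
  x (rgen (~~ b) i) * y - y * x (rgen (~~ b) i) =
  (\sum_l pi b y (u l * x (rgen (~~ b) i)) *: v l) * x (tgen b i) -
  x (tgen (~~ b) i) * (\sum_l pi b y (x (rgen (~~ b) i) * u l) *: v l).
Proof.
have Hu l : H (~~ b) (u l) by exact: deg_hopf (uS l).
have Hg : H (~~ b) (x (rgen (~~ b) i)) by exact: hopf_rgen.
have Hug l : H (~~ b) (u l * x (rgen (~~ b) i)) by exact: hopf_mul.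
have Hgu l : H (~~ b) (x (rgen (~~ b) i) * u l) by exact: hopf_mul.
elim/word_span_ind => [|k y1 y2 /deg_hopf h1 IH1 /deg_hopf h2 IH2|w sw].
- rewrite mulr0 mul0r subrr !big1 ?mul0r ?mulr0 ?subrr // => l _;
  by rewrite pair0 // scale0r.
- under [X in _ = X * _ - _]eq_bigr do rewrite (pair_lin piP) // scalerDl -scalerA.
  under [X in _ = _ - _ * X]eq_bigr do rewrite (pair_lin piP) // scalerDl -scalerA.
  rewrite !big_split /= -!scaler_sumr !mulrDr !mulrDl -!scalerAl -!scalerAr.
  rewrite !opprD [RHS]addrACA -!scalerBr -IH1 -IH2 scalerBr.
  by rewrite [LHS]addrACA.
move: (sw); rewrite deg_wordE => /andP[/is_rgen_map[w' def_w] _].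
rewrite {w}def_w in sw *.
rewrite (rgen_word_comm rel) scalerBr addrC; congr (_ + _).
  rewrite -scalerN scalerN -scaleNr scalerAl; congr (_ * _).
  have Sr := deg_minus_add sw (rskew_deg b i w').
  rewrite {1}(dual_expand Sr) scaler_sumr; apply: eq_bigr => l _.
  by rewrite scalerA pair_rskew //; exact: deg_span (uS l).
rewrite -mulrN scalerAr; congr (_ * _).
have Sl := deg_minus_add sw (lskew_deg b i w').
rewrite {1}(dual_expand Sl) scaler_sumr -sumrN; apply: eq_bigr => l _.
by rewrite scalerA pair_lskew // mulNr scaleNr opprK.
Qed.

End DualBases.
End Adjunction.

(** * The telescoping identities *)

Section Casimir.
Variables (K : fieldType) (n : nat) (A : algType K) (x : gen n -> A).
Variables (q : 'I_n -> 'I_n -> K) (c : 'I_n -> K).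
Hypothesis rel : side_rel x q c.
Variable pi : bool -> A -> A -> K.
Hypothesis piP : side_pairing x q c pi.
Local Notation Sd b z := (word_span x (deg_word b z)).

Record alg_antipode (S : A -> A) : Prop := {
  alg_antipode_lin : forall k a b, S (k *: a + b) = k *: S a + S b;
  alg_antipodeM : forall a b, S (a * b) = S b * S a;
  alg_antipodeE : forall g, S (x g) = antipode_gen x g
}.

Record alg_dual_bases (d : Qplus n -> nat) (u v : forall z, 'I_(d z) -> A) :
    Prop := {
  dual_u : forall z l, Sd true z (u z l);
  dual_v : forall z l, Sd false z (v z l);
  dual_u_gen : forall z a, Sd true z a ->
    exists k : 'I_(d z) -> K, a = \sum_l k l *: u z l;
  dual_v_gen : forall z a, Sd false z a ->
    exists k : 'I_(d z) -> K, a = \sum_l k l *: v z l;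
  dual_uv : forall z j k, pi false (v z j) (u z k) = (j == k)%:R
}.

Variable S : A -> A.
Hypothesis SP : alg_antipode S.

Lemma alg_antipodeD a b : S (a + b) = S a + S b.
Proof. by have := alg_antipode_lin SP 1 a b; rewrite !scale1r. Qed.

Lemma alg_antipode0 : S 0 = 0.
Proof. by apply: (addrI (S 0)); rewrite -alg_antipodeD !addr0. Qed.

Lemma alg_antipodeZ k a : S (k *: a) = k *: S a.
Proof. by have := alg_antipode_lin SP k a 0; rewrite alg_antipode0 !addr0. Qed.

Lemma alg_antipodeB a b : S (a - b) = S a - S b.
Proof. by rewrite alg_antipodeD -scaleN1r alg_antipodeZ scaleN1r. Qed.

Lemma alg_antipode_sum I (t : seq I) (k : I -> K) (f : I -> A) :
  S (\sum_(i <- t) k i *: f i) = \sum_(i <- t) k i *: S (f i).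
Proof.
elim: t => [|i t IH]; first by rewrite !big_nil alg_antipode0.
by rewrite !big_cons (alg_antipode_lin SP) IH.
Qed.

Variables (d : Qplus n -> nat) (u v : forall z, 'I_(d z) -> A).
Arguments u : clear implicits.
Arguments v : clear implicits.
Hypothesis uvP : alg_dual_bases u v.

Definition casimir_deg z := \sum_k S (v z k) * u z k.
(** The terms that telescope: P_z and R_z of the introduction. *)
Definition e_inner i z := \sum_k S (v z k) * (x (Gwi i) * x (Ge i)) * u z k.
Definition f_inner i z := \sum_k S (v z k) * x (Gf i) * u z k.

Lemma expand_v z y : Sd false z y -> y = \sum_l pi false y (u z l) *: v z l.
Proof.
move=> Sy; apply: (dual_expand piP (b := false) (z := z)) => //.
- exact: (dual_u uvP).
- exact: (dual_v uvP).
- exact: (dual_v_gen uvP).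
- exact: (dual_uv uvP).
Qed.

Lemma dual_uv_sym z j k : pi true (u z j) (v z k) = (j == k)%:R.
Proof. by rewrite -(pair_sym piP true) (dual_uv uvP) eq_sym. Qed.

Lemma expand_u z y : Sd true z y -> y = \sum_l pi false (v z l) y *: u z l.
Proof.
move=> Sy.
have := dual_expand (b := true) piP (dual_v uvP (z := z)) (dual_u uvP (z := z))
  (@dual_u_gen _ _ _ uvP z) (@dual_uv_sym z) Sy.
move=> {1}->; apply: eq_bigr => l _.
by rewrite -(pair_sym piP true).
Qed.

Lemma deg_mul_rgen b i z y : Sd b z y ->
  Sd b (deg_add z i) (x (rgen b i) * y) /\ Sd b (deg_add z i) (y * x (rgen b i)).
Proof.
move=> Sy.
have Sx : word_span x (pred1 [:: rgen b i]) (x (rgen b i)).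
  by rewrite -(mon1 x (rgen b i)); apply: word_span_mon; rewrite /= eqxx.
have hc w : deg_word b z w ->
    deg_word b (deg_add z i) (rgen b i :: w) /\
    deg_word b (deg_add z i) (w ++ [:: rgen b i]).
  rewrite !deg_wordE all_cat /= is_rgen_rgen => /andP[-> /forallP h].
  split; apply/forallP => j; rewrite ?count_cat /= ffunE -(eqP (h j));
    by rewrite (inj_eq (@rgen_inj _ b)) (eq_sym j) ?addn0 // addnC.
split; [apply: word_spanM Sx Sy|apply: word_spanM Sy Sx] => w w'.
  by move=> /eqP-> /hc[].
by move=> /hc[_ h] /eqP->.
Qed.

(** The initial terms of the telescoping sum: e_i commutes with the elements of
    the negative part whose degree does not involve the i-th simple root. *)
Lemma casimir_deg_e0 i (z : Qplus n) : z i = 0%N ->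
  x (Gwi i) * x (Ge i) * casimir_deg z = e_inner i z.
Proof.
move=> zi; rewrite mulr_sumr; apply: eq_bigr => k _; rewrite mulrA; congr (_ * _).
have /(congr1 S) := rgen_deg_comm0 rel zi (dual_v uvP k).
rewrite !(alg_antipodeM SP) (alg_antipodeE SP) /= mulrN mulNr.
by move/oppr_inj.
Qed.

(** Apply S to [rgen_deg_comm] for y = v_k and collapse the sum over k, using
    sum_k <v_k, a> u_k = a for a = e_i u_l and a = u_l e_i. *)
Lemma casimir_deg_eS i z : x (Gwi i) * x (Ge i) * casimir_deg (deg_add z i) =
  e_inner i (deg_add z i) - e_inner i z + x (Gwi' i) * casimir_deg z * x (Ge i).
Proof.
have E k : x (Gwi i) * x (Ge i) * S (v (deg_add z i) k) =
  S (v (deg_add z i) k) * (x (Gwi i) * x (Ge i))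
  - (\sum_l pi false (v (deg_add z i) k) (x (Ge i) * u z l) *: S (v z l)) *
    x (Gwi i)
  + x (Gwi' i) *
    (\sum_l pi false (v (deg_add z i) k) (u z l * x (Ge i)) *: S (v z l)).
  have /(congr1 S) := rgen_deg_comm (b := false) rel piP
     (dual_u uvP (z := z)) (dual_v uvP (z := z))
     (@dual_v_gen _ _ _ uvP z) (dual_uv uvP (z := z)) (dual_v uvP k).
  rewrite !alg_antipodeB !(alg_antipodeM SP) !(alg_antipodeE SP) /=.
  rewrite !alg_antipode_sum mulrN mulNr opprK.
  move=> h; rewrite -addrA [- _ + _]addrC -h.
  by rewrite addrA addrN add0r.
rewrite {1}/casimir_deg mulr_sumr.
under eq_bigr => k _ do rewrite mulrA E mulrDl mulrBl.
rewrite big_split sumrB /=; congr (_ - _ + _).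
  under eq_bigr => k _ do rewrite -mulrA mulr_suml.
  rewrite exchange_big; apply: eq_bigr => l _.
  have Su := (deg_mul_rgen i (dual_u uvP l)).1.
  rewrite -[S _ * _ * _]mulrA -[x (Gwi i) * _ * _]mulrA {2}(expand_u Su) /=.
  rewrite !mulr_sumr.
  by apply: eq_bigr => k _; rewrite -!scalerAl -!scalerAr.
under eq_bigr => k _ do rewrite -mulrA mulr_suml mulr_sumr.
rewrite exchange_big mulr_sumr mulr_suml; apply: eq_bigr => l _.
have Su := (deg_mul_rgen i (dual_u uvP l)).2.
rewrite -!mulrA {2}(expand_u Su) /= !mulr_sumr.
by apply: eq_bigr => k _; rewrite -!scalerAl -!scalerAr.
Qed.

Lemma casimir_deg_f0 i (z : Qplus n) : z i = 0%N ->
  casimir_deg z * x (Gf i) = f_inner i z.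
Proof.
move=> zi; rewrite mulr_suml; apply: eq_bigr => k _; rewrite -!mulrA.
by rewrite (rgen_deg_comm0 rel zi (dual_u uvP k)).
Qed.

(** Here [rgen_deg_comm] is applied to y = u_k on the side b = true, and the sum
    over k collapses by sum_k <a, u_k> v_k = a for a = f_i v_l and a = v_l f_i;
    S then moves f_i to the other end of these products. *)
Lemma casimir_deg_fS i z : casimir_deg (deg_add z i) * x (Gf i) =
  f_inner i (deg_add z i) - f_inner i z +
  x (Gf i) * x (Gwi' i) * casimir_deg z * x (Gw i).
Proof.
have E k : u (deg_add z i) k * x (Gf i) = x (Gf i) * u (deg_add z i) k +
   x (Gw' i) * (\sum_l pi false (x (Gf i) * v z l) (u (deg_add z i) k) *: u z l)
   - (\sum_l pi false (v z l * x (Gf i)) (u (deg_add z i) k) *: u z l) * x (Gw i).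
  have := rgen_deg_comm (b := true) rel piP
     (dual_v uvP (z := z)) (dual_u uvP (z := z))
     (@dual_u_gen _ _ _ uvP z) (@dual_uv_sym z) (dual_u uvP k).
  under eq_bigr do rewrite -(pair_sym piP true).
  under [X in _ = _ - _ * X]eq_bigr do rewrite -(pair_sym piP true).
  move=> /= h; rewrite -addrA -[X in _ + X]opprB -h opprB.
  by rewrite addrC subrK.
rewrite {1}/casimir_deg mulr_suml.
under eq_bigr => k _ do rewrite -mulrA E mulrBr mulrDr mulrA.
rewrite sumrB big_split /= -!addrA; congr (_ + _).
have Sf : S (x (Gf i)) = - (x (Gf i) * x (Gwi' i)) by rewrite (alg_antipodeE SP).
congr (_ + _).
  rewrite -sumrN.
  under eq_bigr => k _ do rewrite !mulr_sumr.
  rewrite exchange_big; apply: eq_bigr => l _.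
  have Sv := (deg_mul_rgen i (dual_v uvP l)).1.
  have -> : S (v z l) * x (Gf i) * u z l = - S (x (Gf i) * v z l) * x (Gw' i) * u z l.
    rewrite (alg_antipodeM SP) Sf mulrN opprK -!mulrA (mulrA (x (Gwi' i))).
    rewrite (side_toral rel) //; first by rewrite (side_kK rel false) mul1r.
  rewrite {2}(expand_v Sv) alg_antipode_sum !mulNr opprK !mulr_suml.
  apply: eq_bigr => k _.
  by rewrite -!scalerAl -!scalerAr mulrA.
rewrite -sumrN.
under eq_bigr => k _ do rewrite mulr_suml mulr_sumr -sumrN.
rewrite exchange_big mulr_sumr mulr_suml; apply: eq_bigr => l _.
have Sv := (deg_mul_rgen i (dual_v uvP l)).2.
have -> : x (Gf i) * x (Gwi' i) * (S (v z l) * u z l) * x (Gw i) =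
   - (S (v z l * x (Gf i)) * u z l * x (Gw i)).
  by rewrite (alg_antipodeM SP) Sf !mulNr opprK !mulrA.
rewrite {2}(expand_v Sv) alg_antipode_sum !mulr_suml -sumrN.
apply: eq_bigr => k _.
by rewrite -!scalerAl -!scalerAr mulrA.
Qed.

Lemma tinvK b i : x (tinv b i) * x (tgen b i) = 1.
Proof. by rewrite (side_toral rel) ?(side_kK rel) //; case: b. Qed.

Definition deg_prod (z : Qplus n) (f : 'I_n -> K) := \prod_j f j ^+ z j.

Lemma deg_prodE b z w f : deg_word b z (map (rgen b) w) ->
  \prod_(k <- w) f k = deg_prod z f.
Proof.
rewrite deg_wordE => /andP[_ /forallP h].
rewrite /deg_prod [RHS](eq_bigr (fun j => f j ^+ count_mem j w)); last first.
  move=> j _; rewrite -(eqP (h j)) count_map; congr (_ ^+ _).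
  by apply: eq_count => k /=; rewrite (inj_eq (@rgen_inj _ b)).
elim: w {h} => [|j w IH]; first by rewrite big_nil big1 // => j _; rewrite expr0.
rewrite big_cons IH /=.
rewrite [RHS](eq_bigr (fun k => f k ^+ (j == k) * f k ^+ count_mem k w)).
  rewrite big_split /=; congr (_ * _).
  rewrite (bigD1 j) //= eqxx expr1 big1 ?mulr1 // => k /negPf.
  by rewrite eq_sym => ->.
by move=> k _; rewrite exprD.
Qed.

Lemma tgen_deg b i z y : Sd b z y ->
  x (tgen b i) * y = deg_prod z (side_br q b i) *: (y * x (tgen b i)).
Proof.
elim/word_span_ind => [|k y1 y2 _ IH1 _ IH2|w sw].
- by rewrite mulr0 mul0r scaler0.
- rewrite mulrDr mulrDl -scalerAl -scalerAr IH1 IH2 scalerDr !scalerA.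
  by rewrite mulrC.
move: (sw); rewrite deg_wordE => /andP[/is_rgen_map[w' def_w] _].
by rewrite def_w in sw *; rewrite (tgen_word rel) (deg_prodE _ sw).
Qed.

Lemma deg_tgen b i z y : Sd b z y ->
  y * x (tgen (~~ b) i) =
  deg_prod z (side_br q b ^~ i) *: (x (tgen (~~ b) i) * y).
Proof.
elim/word_span_ind => [|k y1 y2 _ IH1 _ IH2|w sw].
- by rewrite mulr0 mul0r scaler0.
- rewrite mulrDr mulrDl -scalerAl -scalerAr IH1 IH2 scalerDr !scalerA.
  by rewrite mulrC.
move: (sw); rewrite deg_wordE => /andP[/is_rgen_map[w' def_w] _].
by rewrite def_w in sw *; rewrite (word_tgen rel) (deg_prodE _ sw).
Qed.

Lemma twisted_comm_invr (k ki y : A) a : k * ki = 1 -> ki * k = 1 ->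
  k * y = a *: (y * k) -> y * ki = a *: (ki * y).
Proof.
move=> kK Kk h; rewrite -[y in LHS]mul1r -Kk -(mulrA ki) h -scalerAr -scalerAl.
by rewrite -!mulrA kK mulr1.
Qed.

Lemma twisted_comm_invl (k ki y : A) a : k * ki = 1 -> ki * k = 1 ->
  y * k = a *: (k * y) -> ki * y = a *: (y * ki).
Proof.
move=> kK Kk h; rewrite -[y in LHS]mulr1 -kK (mulrA y) h -scalerAl -scalerAr.
by rewrite !mulrA Kk mul1r.
Qed.

Lemma deg_prod_neq0 z f : (forall j, f j != 0) -> deg_prod z f != 0.
Proof. by move=> f0; apply/prodf_neq0 => j _; rewrite expf_neq0. Qed.

(** S(v_k) and u_k have opposite degrees, so the scalars that appear when the
    toral element passes each of them are inverse to each other. *)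
Lemma casimir_deg_tinv b i z :
  x (tinv b i) * casimir_deg z = casimir_deg z * x (tinv b i).
Proof.
rewrite mulr_sumr mulr_suml; apply: eq_bigr => k _.
have q0 := side_q rel.
have kK := side_kK rel b i; have Kk := tinvK b i.
have Sk : S (x (tgen b i)) = x (tinv b i) by rewrite (alg_antipodeE SP); case: (b).
case: b kK Kk Sk => /= kK Kk Sk.
  have /(congr1 S) := deg_tgen (b := false) i (dual_v uvP k).
  rewrite alg_antipodeZ !(alg_antipodeM SP) Sk => h1.
  have h2 := twisted_comm_invr kK Kk (tgen_deg (b := true) i (dual_u uvP k)).
  by rewrite mulrA h1 -scalerAl -!mulrA h2 -scalerAr.
have /(congr1 S) := tgen_deg (b := false) i (dual_v uvP k).
rewrite alg_antipodeZ !(alg_antipodeM SP) Sk => h1.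
have h2 := twisted_comm_invl kK Kk (deg_tgen (b := true) i (dual_u uvP k)).
have Q0 : deg_prod z (side_br q false i) != 0 by exact: deg_prod_neq0.
apply: (scalerI Q0).
by rewrite mulrA scalerAl -h1 -!mulrA h2 -!scalerAr.
Qed.

Lemma casimir_deg_tgen b i z :
  x (tgen b i) * casimir_deg z = casimir_deg z * x (tgen b i).
Proof.
have h : x (tinv b i) * casimir_deg z = 1 *: (casimir_deg z * x (tinv b i)).
  by rewrite scale1r casimir_deg_tinv.
by have := twisted_comm_invr (tinvK b i) (side_kK rel b i) h; rewrite scale1r.
Qed.

End Casimir.

(** * The Casimir operator on a module *)

Section FiniteSums.
Variables (n : nat) (V : zmodType).
Local Notation Q := (Qplus n).

Lemma fsum_add (D : {fset Q}) (F G : Q -> V) :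
  (forall z, z \notin D -> F z = 0) -> (forall z, z \notin D -> G z = 0) ->
  \sum_(z \in [set: Q]) (F z + G z) =
  \sum_(z \in [set: Q]) F z + \sum_(z \in [set: Q]) G z.
Proof.
move=> F0 G0; rewrite !(@fsbigTE _ _ _ _ D) ?big_split //.
by move=> z zD; rewrite F0 // G0 // addr0.
Qed.

(** Reindexing by z |-> z + a_i is a bijection onto the degrees in which the
    i-th coordinate is positive; this is how the telescoping identities are
    summed. *)
Lemma fsum_shift (D : {fset Q}) i (F P G : Q -> V) :
  (forall z, z \notin D -> P z = 0) -> (forall z, z \notin D -> G z = 0) ->
  (forall z : Q, z i = 0%N -> F z = P z) ->
  (forall z, F (deg_add z i) = P (deg_add z i) + G z) ->
  \sum_(z \in [set: Q]) F z = \sum_(z \in [set: Q]) (P z + G z).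
Proof.
move=> P0 G0 Fb Fs.
pose subz (z : Q) : Q := [ffun j => (z j - (j == i))%N].
have addzK : cancel (fun z => deg_add z i) subz.
  by move=> z; apply/ffunP => j; rewrite !ffunE addKn.
have subzK (z : Q) : z i <> 0%N -> deg_add (subz z) i = z.
  move=> /eqP zi; apply/ffunP => j; rewrite !ffunE.
  by have [->|_] := eqVneq j i; rewrite /= ?subn0 // subnKC // lt0n.
pose Gs (z : Q) := if z i == 0%N then 0 else G (subz z).
have FE z : F z = P z + Gs z.
  rewrite /Gs; case: eqP => [/Fb|/subzK zE]; first by rewrite addr0.
  by rewrite -{1 2}zE Fs.
have GsE : \sum_(z \in [set: Q]) Gs z = \sum_(z \in [set: Q]) G z.
  rewrite -(@fsbig_widen _ _ _ _ [set z : Q | z i != 0%N]%classic); last 2 first.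
  - by [].
  - by move=> z [_ /= /negP]; rewrite negbK /Gs => ->.
  rewrite (@reindex_fsbig _ _ _ _ _ (fun z => deg_add z i) setT); last first.
    split=> [z _ /=|z z' _ _ /(can_inj addzK)|z /= /eqP zi] //.
      by rewrite ffunE eqxx.
    by exists (subz z) => //; exact: subzK.
  apply: eq_fsbigr => z _; rewrite /Gs addzK ffunE eqxx //.
pose D' := (D `|` [fset deg_add z i | z in D])%fset.
have Gs0 z : z \notin D' -> Gs z = 0.
  rewrite inE negb_or /Gs => /andP[_ zD]; case: eqP => // /subzK zi.
  by apply: G0; apply: contra zD => zD; apply/imfsetP; exists (subz z).
have P0' z : z \notin D' -> P z = 0.
  by rewrite inE negb_or => /andP[/P0].
rewrite (@fsum_add D) // -GsE -(@fsum_add D') //.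
by apply: eq_fsbigr => z _.
Qed.

End FiniteSums.

Lemma fsum_map (n : nat) (V W : zmodType) (D : {fset Qplus n}) (f : {additive V -> W})
   (F : Qplus n -> V) : (forall z, z \notin D -> F z = 0) ->
  f (\sum_(z \in [set: Qplus n]) F z) = \sum_(z \in [set: Qplus n]) f (F z).
Proof.
move=> F0; rewrite !(@fsbigTE _ _ _ _ D) ?raddf_sum //.
by move=> z zD; rewrite F0 // raddf0.
Qed.

Section CasimirOperator.
Variables (K : fieldType) (n : nat) (A : algType K) (x : gen n -> A).
Variables (q : 'I_n -> 'I_n -> K) (c : 'I_n -> K).
Hypothesis rel : side_rel x q c.
Variable pi : bool -> A -> A -> K.
Hypothesis piP : side_pairing x q c pi.
Variable S : A -> A.
Hypothesis SP : alg_antipode x S.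
Variables (d : Qplus n -> nat) (u v : forall z, 'I_(d z) -> A).
Arguments u : clear implicits.
Arguments v : clear implicits.
Hypothesis uvP : alg_dual_bases x pi u v.
Variable M : lmodType A.

(** What makes Omega a finite sum on every vector: the positive part kills it in
    almost all degrees. *)
Definition locally_finite := forall m : M, exists D : {fset Qplus n}, forall z y,
  z \notin D -> word_span x (deg_word true z) y -> y *: m = 0.
Hypothesis fin : locally_finite.

Local Notation casimir_deg := (casimir_deg S u v).
Definition casimir_op (m : M) : M := \sum_(z \in [set: Qplus n]) casimir_deg z *: m.

Lemma sum_fin (m : M) (D : {fset Qplus n}) z (t : 'I_(d z) -> A) :
  (forall z y, z \notin D -> word_span x (deg_word true z) y -> y *: m = 0) ->
  z \notin D -> (\sum_k t k * u z k) *: m = 0.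
Proof.
move=> Dm zD; rewrite scaler_suml big1 // => k _.
by rewrite -scalerA (Dm _ _ zD (dual_u uvP k)) scaler0.
Qed.

Lemma casimir_opD m m' : casimir_op (m + m') = casimir_op m + casimir_op m'.
Proof.
have [D Dm] := fin m; have [D' Dm'] := fin m'.
rewrite /casimir_op -(@fsum_add _ _ (D `|` D')%fset).
- by apply: eq_fsbigr => z _; rewrite scalerDr.
- by move=> z; rewrite inE negb_or => /andP[h _]; exact: sum_fin Dm h.
- by move=> z; rewrite inE negb_or => /andP[_ h]; exact: sum_fin Dm' h.
Qed.

Lemma scaler_casimir_op a m : a *: casimir_op m =
  \sum_(z \in [set: Qplus n]) a *: (casimir_deg z *: m).
Proof.
have [D Dm] := fin m.
by apply: (@fsum_map _ M M D (@GRing.scale A M a)) => z zD; exact: sum_fin Dm zD.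
Qed.

Lemma casimir_op_comm a (m : M) :
  (forall z, a * casimir_deg z = casimir_deg z * a) ->
  casimir_op (a *: m) = a *: casimir_op m.
Proof.
move=> aC; rewrite scaler_casimir_op; apply: eq_fsbigr => z _.
by rewrite !scalerA aC.
Qed.

Lemma casimir_opZ (k : K) m : casimir_op (k%:A *: m) = k%:A *: casimir_op m.
Proof. by apply: casimir_op_comm => z; rewrite mulr_algl mulr_algr. Qed.

Lemma casimir_op0 : casimir_op 0 = 0.
Proof. by apply: (addrI (casimir_op 0)); rewrite -casimir_opD addr0 [RHS]addr0. Qed.

Lemma casimir_op_tgen b i m :
  casimir_op (x (tgen b i) *: m) = x (tgen b i) *: casimir_op m.
Proof. by apply: casimir_op_comm => z; exact: (casimir_deg_tgen rel SP uvP). Qed.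

Lemma casimir_op_tinv b i m :
  casimir_op (x (tinv b i) *: m) = x (tinv b i) *: casimir_op m.
Proof. by apply: casimir_op_comm => z; exact: (casimir_deg_tinv rel SP uvP). Qed.

Lemma casimir_op_e i m :
  (x (Gwi i) * x (Ge i)) *: casimir_op m = x (Gwi' i) *: casimir_op (x (Ge i) *: m).
Proof.
have [D Dm] := fin m; have [D' Dm'] := fin (x (Ge i) *: m).
(* G (z - a_i) is what the identity in degree z adds to P z. The - P in it
   cancels against P after the shift of the summation. *)
pose P z := e_inner x S u v i z *: m.
pose G z := - P z + x (Gwi' i) *: (casimir_deg z *: (x (Ge i) *: m)).
have P0 z : z \notin (D `|` D')%fset -> P z = 0.
  by rewrite inE negb_or => /andP[h _]; exact: sum_fin Dm h.
rewrite !scaler_casimir_op (@fsum_shift _ _ (D `|` D')%fset i _ P G) //.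
- by apply: eq_fsbigr => z _; rewrite addrA subrr add0r.
- move=> z; rewrite inE negb_or => h; rewrite /G P0 ?inE ?negb_or //.
  by case/andP: h => _ h; rewrite (sum_fin _ Dm' h) scaler0 oppr0 addr0.
- by move=> z zi; rewrite scalerA (casimir_deg_e0 rel SP uvP).
move=> z; rewrite scalerA (casimir_deg_eS rel piP SP uvP).
by rewrite /G !scalerDl addrA scaleNr !scalerA ?mulrA.
Qed.

Lemma casimir_op_f i m :
  casimir_op (x (Gf i) *: m) = (x (Gf i) * x (Gwi' i)) *: casimir_op (x (Gw i) *: m).
Proof.
have [D Dm] := fin m; have [D' Dm'] := fin (x (Gw i) *: m).
pose P z := f_inner x S u v i z *: m.
pose G z := - P z + (x (Gf i) * x (Gwi' i)) *: (casimir_deg z *: (x (Gw i) *: m)).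
have P0 z : z \notin (D `|` D')%fset -> P z = 0.
  by rewrite inE negb_or => /andP[h _]; exact: sum_fin Dm h.
rewrite scaler_casimir_op /casimir_op (@fsum_shift _ _ (D `|` D')%fset i _ P G) //.
- by apply: eq_fsbigr => z _; rewrite addrA subrr add0r.
- move=> z; rewrite inE negb_or => h; rewrite /G P0 ?inE ?negb_or //.
  by case/andP: h => _ h; rewrite (sum_fin _ Dm' h) scaler0 oppr0 addr0.
- by move=> z zi; rewrite scalerA (casimir_deg_f0 rel _ uvP).
move=> z; rewrite scalerA (casimir_deg_fS rel piP SP uvP).
by rewrite /G !scalerDl addrA scaleNr !scalerA ?mulrA.
Qed.

Local Notation wt := 'rV[rat]_n.
Local Notation del i := (delta_mx 0 i : wt).
Variables (Lam : wt -> Prop) (chi chi' : wt -> 'I_n -> K) (eig : wt -> K).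

Definition weight_vector (l : wt) (m : M) := forall i,
  x (Gw i) *: m = (chi l i)%:A *: m /\ x (Gw' i) *: m = (chi' l i)%:A *: m.

(** chi l i and chi' l i are the eigenvalues of w_i and w'_i on vectors of weight
    l, and eig l that of omega. The last condition is the one that makes
    Omega omega commute with U: eig changes by the eigenvalue of w_i w'_i^-1. *)
Record weight_data : Prop := {
  Lam_add : forall l i, Lam l -> Lam (l + del i);
  Lam_sub : forall l i, Lam l -> Lam (l - del i);
  chi_add : forall l i j, chi (l + del i) j = q i j * chi l j;
  chi'_add : forall l i j, chi' (l + del i) j = (q j i)^-1 * chi' l j;
  chi'_neq0 : forall l i, chi' l i != 0;
  eig_add : forall l i,
    eig (l + del i) = eig l * (chi (l + del i) i / chi' (l + del i) i)
}.

Hypothesis WD : weight_data.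

Lemma scaleAC (k : K) (a : A) (m : M) : a *: (k%:A *: m) = k%:A *: (a *: m).
Proof. by rewrite !scalerA mulr_algl mulr_algr. Qed.

Lemma scalerKA (k : K) (a : A) (m : M) : (k *: a) *: m = k%:A *: (a *: m).
Proof. by rewrite scalerA mulr_algl. Qed.

Lemma scalerAA (k k' : K) (m : M) : k%:A *: (k'%:A *: m) = (k * k')%:A *: m.
Proof. by rewrite scalerA mulr_algl scalerA. Qed.

Lemma scalerAI (k : K) (m m' : M) : k != 0 -> k%:A *: m = k%:A *: m' -> m = m'.
Proof.
move=> k0 /(congr1 (fun m => k^-1%:A *: m)).
by rewrite !scalerAA mulVf // !scale1r.
Qed.

Lemma weight_vector_e l i m : weight_vector l m ->
  weight_vector (l + del i) (x (Ge i) *: m).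
Proof.
move=> lm j; have [h1 h2] := lm j; rewrite (chi_add WD) (chi'_add WD); split.
  rewrite scalerA (side_kg rel true j i) scalerKA -scalerA h1 scaleAC.
  by rewrite scalerAA.
have q0 := side_q rel j i.
apply: (scalerAI q0); rewrite scalerAA mulrA mulfV // mul1r.
rewrite scalerA -scalerKA -(side_gk rel true j i) -scalerA h2 scaleAC.
by [].
Qed.

Lemma weight_vector_f l i m : weight_vector l m ->
  weight_vector (l - del i) (x (Gf i) *: m).
Proof.
move=> lm j; have [h1 h2] := lm j.
have := chi_add WD (l - del i) i j; have := chi'_add WD (l - del i) i j.
have q0 := side_q rel; rewrite subrK => E' E; split.
  apply: (scalerAI (q0 i j)); rewrite scalerAA -E.
  by rewrite scalerA -scalerKA -(side_gk rel false j i) -scalerA h1 scaleAC.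
rewrite scalerA (side_kg rel false j i) scalerKA -scalerA h2 scaleAC scalerAA E'.
by rewrite /= mulrA mulfV ?mul1r.
Qed.

Variable om : M -> M.
Hypothesis om_lin : forall (k : K) m1 m2,
  om (k%:A *: m1 + m2) = k%:A *: om m1 + om m2.
Hypothesis om_weight : forall l m, Lam l -> weight_vector l m ->
  om m = (eig l)%:A *: m.
Hypothesis wt_sum : forall m : M, exists2 t : seq (wt * M),
  {in t, forall p, Lam p.1 /\ weight_vector p.1 p.2} & m = \sum_(p <- t) p.2.
Hypothesis mon_gen : forall a : A, word_span x predT a.

Local Notation C m := (casimir_op (om m)).

Lemma omegaD m m' : om (m + m') = om m + om m'.
Proof. by have := om_lin 1 m m'; rewrite !scale1r. Qed.

Lemma omega0 : om 0 = 0.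
Proof. by apply: (addrI (om 0)); rewrite -omegaD addr0 [RHS]addr0. Qed.

Lemma casimir_omegaD m m' : C (m + m') = C m + C m'.
Proof. by rewrite omegaD casimir_opD. Qed.

Lemma casimir_omega0 : C 0 = 0.
Proof. by rewrite omega0 casimir_op0. Qed.

Lemma casimir_omegaZ (k : K) m : C (k%:A *: m) = k%:A *: C m.
Proof. by have := om_lin k m 0; rewrite omega0 !addr0 => ->; rewrite casimir_opZ. Qed.

Lemma casimir_omega_weight a :
  (forall l m, Lam l -> weight_vector l m -> C (a *: m) = a *: C m) ->
  forall m, C (a *: m) = a *: C m.
Proof.
move=> H m; have [t tP ->] := wt_sum m.
rewrite big_seq; elim/big_rec: _ => [|p m' pt IH].
  by rewrite scaler0 casimir_omega0 scaler0.
have [h1 h2] := tP p pt.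
by rewrite scalerDr !casimir_omegaD scalerDr IH (H p.1).
Qed.

Lemma weight_vector_tinv b i l m : weight_vector l m ->
  exists k : K, x (tinv b i) *: m = k%:A *: m.
Proof.
have key (k : K) : x (tgen b i) *: m = k%:A *: m ->
    exists k : K, x (tinv b i) *: m = k%:A *: m.
  move=> h; have [k0|k0] := eqVneq k 0.
    exists 0; move: h; rewrite k0 scale0r scale0r => h.
    by rewrite -[m]scale1r -(tinvK rel b i) -(scalerA _ _ m) h !scaler0.
  exists k^-1; apply: (scalerAI k0).
  by rewrite -[LHS]scaleAC -h [LHS]scalerA (tinvK rel) scalerAA mulfV // !scale1r.
move=> lm; have [h1 h2] := lm i.
by case: b key => key; [exact: key h1|exact: key h2].
Qed.

Lemma casimir_omega_tgen b i m : C (x (tgen b i) *: m) = x (tgen b i) *: C m.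
Proof.
move: m; apply: casimir_omega_weight => l m Ll lm.
rewrite (om_weight Ll lm) casimir_opZ scaleAC -casimir_op_tgen.
have [k E] : exists k : K, x (tgen b i) *: m = k%:A *: m.
  by have [h1 h2] := lm i; case: b; [exists (chi l i)|exists (chi' l i)].
by rewrite E casimir_omegaZ (om_weight Ll lm) !casimir_opZ !scalerAA mulrC.
Qed.

Lemma casimir_omega_tinv b i m : C (x (tinv b i) *: m) = x (tinv b i) *: C m.
Proof.
move: m; apply: casimir_omega_weight => l m Ll lm.
rewrite (om_weight Ll lm) casimir_opZ scaleAC -casimir_op_tinv.
have [k E] := weight_vector_tinv b i lm.
by rewrite E casimir_omegaZ (om_weight Ll lm) !casimir_opZ !scalerAA mulrC.
Qed.

Lemma casimir_op_weight l m : weight_vector l m -> weight_vector l (casimir_op m).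
Proof.
move=> lm i; have [h1 h2] := lm i; split.
  by rewrite -(casimir_op_tgen true) h1 casimir_opZ.
by rewrite -(casimir_op_tgen false) h2 casimir_opZ.
Qed.

Lemma casimir_omega_e i m : C (x (Ge i) *: m) = x (Ge i) *: C m.
Proof.
move: m; apply: casimir_omega_weight => l m Ll lm.
have lem := weight_vector_e i lm; have Lle := Lam_add WD i Ll.
rewrite (om_weight Ll lm) (om_weight Lle lem) !casimir_opZ scaleAC (eig_add WD) -scalerAA.
congr (_ *: _).
have -> : x (Ge i) *: casimir_op m =
    (x (Gw i) * x (Gwi' i)) *: casimir_op (x (Ge i) *: m).
  rewrite -[x (Gw i) * _ *: _]scalerA -casimir_op_e scalerA mulrA.
  by rewrite (side_kK rel true i) mul1r.
have [h1 h2] := casimir_op_weight lem i.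
have c0 := chi'_neq0 WD (l + del i) i.
apply: (scalerAI c0); rewrite scalerAA mulrCA mulfV // mulr1.
by rewrite -scaleAC -h2 -h1 scalerA -mulrA (tinvK rel false) mulr1.
Qed.

Lemma casimir_omega_f i m : C (x (Gf i) *: m) = x (Gf i) *: C m.
Proof.
move: m; apply: casimir_omega_weight => l m Ll lm.
have lfm := weight_vector_f i lm; have Llf := Lam_sub WD i Ll.
have [h1 _] := lm i; have [_ h2] := casimir_op_weight lm i.
rewrite (om_weight Ll lm) (om_weight Llf lfm) !casimir_opZ scaleAC casimir_op_f h1 casimir_opZ.
have := eig_add WD (l - del i) i; rewrite subrK => ->.
rewrite -scalerAA; congr (_ *: _).
have c0 := chi'_neq0 WD l i.
rewrite scaleAC -scalerA.
have -> : x (Gwi' i) *: casimir_op m = (chi' l i)^-1%:A *: casimir_op m.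
  apply: (scalerAI c0); rewrite scalerAA mulfV // scale1r scale1r.
  by rewrite -scaleAC -h2 scalerA (tinvK rel false) scale1r.
by rewrite scaleAC scalerAA.
Qed.

Lemma casimir_omega_commutes (a : A) m : C (a *: m) = a *: C m.
Proof.
elim/word_span_ind: (mon_gen a) m => [|k a1 a2 _ IH1 _ IH2|w _] m.
- by rewrite !scale0r casimir_omega0.
- rewrite [in LHS]scalerDl [in LHS]scalerKA casimir_omegaD casimir_omegaZ IH1 IH2.
  by rewrite -scalerKA -scalerDl.
elim: w m => [|g w IH] m; first by rewrite mon_nil !scale1r.
rewrite mon_cons -!scalerA -IH; case: g => i.
- exact: casimir_omega_e.
- exact: casimir_omega_f.
- exact: (casimir_omega_tgen true).
- exact: (casimir_omega_tinv true).
- exact: (casimir_omega_tgen false).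
- exact: (casimir_omega_tinv false).
Qed.

End CasimirOperator.

(** * Root data *)

Section Dot.
Variables (R : comPzRingType) (N : nat).
Implicit Types u v w : 'rV[R]_N.

Lemma dotC u v : dot u v = dot v u.
Proof. by apply: eq_bigr => k _; rewrite mulrC. Qed.

Lemma dotDl u v w : dot (u + v) w = dot u w + dot v w.
Proof. by rewrite /dot -big_split; apply: eq_bigr => k _; rewrite mxE mulrDl. Qed.

Lemma dotDr u v w : dot w (u + v) = dot w u + dot w v.
Proof. by rewrite !(dotC w) dotDl. Qed.

Lemma dotZl a u w : dot (a *: u) w = a * dot u w.
Proof. by rewrite /dot mulr_sumr; apply: eq_bigr => k _; rewrite mxE mulrA. Qed.

Lemma dotZr a u w : dot w (a *: u) = a * dot w u.
Proof. by rewrite !(dotC w) dotZl. Qed.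

Lemma dotNl u w : dot (- u) w = - dot u w.
Proof. by rewrite -scaleN1r dotZl mulN1r. Qed.

Lemma dotNr u w : dot w (- u) = - dot w u.
Proof. by rewrite !(dotC w) dotNl. Qed.

Lemma dot0l u : dot 0 u = 0.
Proof. by rewrite /dot big1 // => k _; rewrite mxE mul0r. Qed.

Lemma dot_suml I (t : seq I) (f : I -> 'rV[R]_N) w :
  dot (\sum_(i <- t) f i) w = \sum_(i <- t) dot (f i) w.
Proof.
elim: t => [|i t IH]; first by rewrite !big_nil dot0l.
by rewrite !big_cons dotDl IH.
Qed.
End Dot.

Arguments eps_dim : simpl never.
Section EpsilonVectors.
Variables (X : lie_type) (n : nat).
Local Notation N := (eps_dim X n).
Local Notation eps k := (eps X n k).
Local Notation al := (@simple_root X n).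

Lemma dot_eps k l : dot (eps k) (eps l) = ((k == l) && (k < N)%N)%:R.
Proof.
rewrite /dot; case: (ltnP k N) => kN.
  rewrite (bigD1 (Ordinal kN)) //= !mxE /= eqxx mul1r andbT big1 ?addr0 // => m.
  by rewrite -val_eqE !mxE /= => /negPf->; rewrite mul0r.
rewrite andbF big1 // => m _; rewrite !mxE.
by have [mk|] := eqVneq (m : nat) k; rewrite ?mul0r //; have := ltn_ord m; lia.
Qed.

Definition dotE := (dotDl, dotDr, dotNl, dotNr, dotZl, dotZr, dot_eps).
End EpsilonVectors.

Definition DeltaX (X : lie_type) : int := if X is TypeB then 2 else 1.

Section SimpleRoots.
Variables (X : lie_type) (n : nat).
Hypothesis simp : is_simple X n.
Local Notation N := (eps_dim X n).
Local Notation eps k := (eps X n k).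
Local Notation al := (@simple_root X n).

(* [lia] discards the inconsistent branches at once, so that only the relative
   positions of the few indices that occur are enumerated. *)
Ltac split_nat :=
  repeat (first [case: eqP => ? | case: ltnP => ?]; try (exfalso; lia)).

(** The symmetrization of the exponents is the invariant form, although the
    exponents themselves are far from symmetric. It is checked type by type. *)
Lemma br_exp_sym i j :
  (br_exp X i j).1 + (br_exp X j i).1 = DeltaX X * dot (al i) (al j) /\
  (br_exp X i j).2 + (br_exp X j i).2 = - (DeltaX X * dot (al i) (al j)).
Proof.
have hi := ltn_ord i; have hj := ltn_ord j.
have eij : (i == j) = ((i : nat) == j) by [].
have eji : (j == i) = ((j : nat) == i) by [].
rewrite /br_exp eij eji /simple_root; case: X simp => /= s0; rewrite /DeltaX.
- split_nat; rewrite /= ?dotE; rewrite /eps_dim; split_nat; split; by [].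
- split_nat; rewrite /= ?dotE; rewrite /eps_dim; split_nat; split; by [].
- split_nat; rewrite /= ?dotE; rewrite /eps_dim; split_nat; split; by [].
- split_nat; rewrite /= ?dotE; rewrite /eps_dim; split_nat; split; by [].
Qed.

Lemma simple_norm i : dot (al i) (al i) =
  (if X is TypeB then if (i.+1 < n)%N then 2 else 1
   else if X is TypeC then if (i.+1 < n)%N then 2 else 4 else 2) :> int.
Proof.
have hi := ltn_ord i; rewrite /simple_root; case: X simp => /= s0;
split_nat; rewrite /= ?dotE; rewrite /eps_dim; split_nat; by [].
Qed.

(** The Cartan integers are integers; only for the long root of type C does this
    depend on more than its length, namely on its divisibility by 2. *)
Lemma coroot_int i j : exists z : int,
  2 * dot (al j) (al i) = z * dot (al i) (al i) :> int.
Proof.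
rewrite simple_norm; case hX : X => /=.
- by exists (dot (simple_root TypeA j) (simple_root TypeA i)); rewrite mulrC.
- case: ifP => _.
    by exists (dot (simple_root TypeB j) (simple_root TypeB i)); rewrite mulrC.
  by exists (2 * dot (simple_root TypeB j) (simple_root TypeB i)); rewrite mulr1.
- case: ifP => hi.
    by exists (dot (simple_root TypeC j) (simple_root TypeC i)); rewrite mulrC.
  exists (dot (simple_root TypeC j) (Defs.eps TypeC n i)).
  have -> : simple_root TypeC i = 2 *: Defs.eps TypeC n i by rewrite /simple_root hi.
  by rewrite dotZr mulrA mulrC.
- by exists (dot (simple_root TypeD j) (simple_root TypeD i)); rewrite mulrC.
Qed.

Lemma simple_norm_neq0 i : dot (al i) (al i) != 0.
Proof. by rewrite simple_norm; case: X => //; case: ifP. Qed.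

Definition twice_rho := \sum_(b <- pos_roots X n) b.

Lemma sum_pairs (V : nmodType) (f : nat -> nat -> V) m :
  \sum_(b <- [seq f k l | k <- iota 0 m, l <- iota k.+1 (m - k.+1)]) b =
  \sum_(0 <= k < m) \sum_(k.+1 <= l < m) f k l.
Proof. by rewrite big_allpairs_dep /index_iota subn0. Qed.

(** Covers the roots eps_a - eps_b (t = -1) and eps_a + eps_b (t = 1), a < b: the
    index k occurs N - 1 - k times in first position and k times in second. *)
Lemma sum_eps_pairs k (kN : (k < N)%N) (t : int) :
  dot (\sum_(0 <= a < N) \sum_(a.+1 <= b < N) (eps a + t *: eps b)) (eps k) =
  N%:Z - 1 - k%:Z + t * k%:Z.
Proof.
rewrite dot_suml.
under eq_big_nat => a aN do (rewrite dot_suml;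
  under eq_bigr do rewrite dotDl dotZl !dot_eps; rewrite big_split /=).
rewrite big_split /=; congr (_ + _).
  rewrite (big_cat_nat (n := k)) //=; last exact: ltnW.
  rewrite big_nat big1 => [|a /andP[_ ak]]; last first.
    by rewrite big1 // => b _; rewrite (ltn_eqF ak).
  rewrite add0r big_ltn // [X in _ + X]big_nat.
  rewrite [X in _ + X]big1 ?addr0 => [|a /andP[ak _]]; last first.
    by rewrite big1 // => b _; rewrite (gtn_eqF ak).
  rewrite eqxx kN /= big_const_nat iter_addr_0 natz; lia.
rewrite (big_cat_nat (n := k)) //=; last exact: ltnW.
rewrite [X in _ + X]big_nat.
rewrite [X in _ + X]big1 ?addr0 => [|a /andP[ka _]]; last first.
  rewrite big_nat big1 // => b /andP[ab _].
  by rewrite (gtn_eqF (leq_ltn_trans ka ab)) mulr0.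
rewrite (eq_big_nat _ _ (F2 := fun=> t)); last first.
  move=> a /andP[_ ak]; rewrite (big_cat_nat (n := k)) //=; last exact: ltnW.
  rewrite big_nat big1 ?add0r => [|b /andP[_ bk]]; last first.
    by rewrite (ltn_eqF bk) mulr0.
  rewrite big_ltn // eqxx kN mulr1 big_nat big1 ?addr0 // => b /andP[kb _].
  by rewrite (gtn_eqF kb) mulr0.
by rewrite big_const_nat iter_addr_0 subn0 -mulr_natr natz.
Qed.

Lemma sum_eps_single k (kN : (k < N)%N) (t : int) :
  dot (\sum_(0 <= a < N) (t *: eps a)) (eps k) = t.
Proof.
rewrite dot_suml (big_cat_nat (n := k)) //=; last exact: ltnW.
rewrite big_nat big1 ?add0r => [|a /andP[_ ak]]; last first.
  by rewrite dotZl dot_eps (ltn_eqF ak) mulr0.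
rewrite big_ltn // big_nat big1 ?addr0 => [|a /andP[ak _]]; last first.
  by rewrite dotZl dot_eps (gtn_eqF ak) mulr0.
by rewrite dotZl dot_eps eqxx kN mulr1.
Qed.

Definition rho_coord (k : nat) : int :=
  match X with
  | TypeA => N%:Z - 1 - 2 * k%:Z
  | TypeB => 2 * (N%:Z - 1 - k%:Z) + 1
  | TypeC => 2 * (N%:Z - 1 - k%:Z) + 2
  | TypeD => 2 * (N%:Z - 1 - k%:Z)
  end.

Lemma dot_twice_rho k (kN : (k < N)%N) : dot twice_rho (eps k) = rho_coord k.
Proof.
have minus := sum_eps_pairs kN (-1); have plus := sum_eps_pairs kN 1.
have Em : \sum_(0 <= a < N) \sum_(a.+1 <= b < N) (eps a + -1 *: eps b) =
   \sum_(b <- [seq eps k - eps l | k <- iota 0 N, l <- iota k.+1 (N - k.+1)]) b.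
  rewrite sum_pairs; apply: eq_bigr => a _; apply: eq_bigr => b _.
  by rewrite scaleN1r.
have Ep : \sum_(0 <= a < N) \sum_(a.+1 <= b < N) (eps a + 1 *: eps b) =
   \sum_(b <- [seq eps k + eps l | k <- iota 0 N, l <- iota k.+1 (N - k.+1)]) b.
  rewrite sum_pairs; apply: eq_bigr => a _; apply: eq_bigr => b _.
  by rewrite scale1r.
have Es t : \sum_(0 <= a < N) (t *: eps a) =
   \sum_(b <- [seq t *: eps k | k <- iota 0 N]) b.
  by rewrite big_map /index_iota subn0.
have Es1 : [seq eps k | k <- iota 0 N] = [seq (1:int) *: eps k | k <- iota 0 N].
  by apply: eq_map => a; rewrite scale1r.
rewrite Em in minus; rewrite Ep in plus.
have single t := sum_eps_single kN t.
rewrite /twice_rho /pos_roots /rho_coord Es1.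
case: X minus plus single Es => /= minus plus single Es.
- by rewrite minus; lia.
- rewrite !big_cat /= !dotDl minus plus -Es single; lia.
- rewrite !big_cat /= !dotDl minus plus -Es single; lia.
- rewrite !big_cat /= !dotDl minus plus; lia.
Qed.

Lemma dot_twice_rho_simple i : dot twice_rho (al i) = dot (al i) (al i).
Proof.
have hi := ltn_ord i; rewrite simple_norm.
have rc k : (k < N)%N -> dot twice_rho (eps k) = rho_coord k by exact: dot_twice_rho.
move: twice_rho rc => P; rewrite /simple_root /rho_coord.
case: X simp P => /= s0 P rc;
  case: ltnP => ?; rewrite ?dotDr ?dotNr ?dotZr !rc /eps_dim; lia.
Qed.

End SimpleRoots.

(** * Weights and the eigenvalues of omega *)

Section Weights.
Variables (X : lie_type) (n : nat).
Hypothesis simp : is_simple X n.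
Local Notation N := (eps_dim X n).
Local Notation al := (@simple_root X n).
Local Notation alQ := (@simple_rootQ X n).
Local Notation wt := 'rV[rat]_n.
Local Notation del i := (delta_mx 0 i : wt).
Local Notation Dx := ((DeltaX X)%:~R : rat).

Lemma dot_intr (m : nat) (u v : 'rV[int]_m) :
  dot (map_mx intr u) (map_mx intr v) = (dot u v)%:~R :> rat.
Proof.
by rewrite /dot rmorph_sum; apply: eq_bigr => k _; rewrite !mxE rmorphM.
Qed.

Lemma sum_del (F : 'I_n -> rat) i : \sum_j F j * del i 0 j = F i.
Proof.
rewrite (bigD1 i) //= mxE !eqxx mulr1 big1 ?addr0 // => j /negPf ji.
by rewrite mxE ji andbF mulr0.
Qed.

Lemma weight_vec_add l i : weight_vec X (l + del i) = weight_vec X l + alQ i.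
Proof.
rewrite /weight_vec.
under eq_bigr do rewrite mxE scalerDl.
rewrite big_split /=; congr (_ + _).
rewrite (bigD1 i) //= mxE !eqxx scale1r big1 ?addr0 // => j /negPf ji.
by rewrite mxE ji andbF scale0r.
Qed.

Lemma coroot_intQ i j : dot (alQ j) (corootQ X i) \is a Num.int.
Proof.
rewrite dotZr !dot_intr; have [z hz] := coroot_int simp i j.
have h0 := simple_norm_neq0 simp i.
have h0' : (dot (al i) (al i))%:~R != 0 :> rat by rewrite intr_eq0.
have -> : 2 / (dot (al i) (al i))%:~R * (dot (al j) (al i))%:~R = z%:~R :> rat.
  by rewrite mulrAC -(intrM _ 2) hz intrM mulfK.
exact: intr_int.
Qed.

Lemma in_Lambda_add l i : in_Lambda X l -> in_Lambda X (l + del i).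
Proof.
by move=> h j; rewrite weight_vec_add dotDl rpredD ?h ?coroot_intQ.
Qed.

Lemma in_Lambda_sub l i : in_Lambda X l -> in_Lambda X (l - del i).
Proof.
move=> h j; have := h j; rewrite -{1}[l](subrK (del i)) weight_vec_add dotDl => hj.
by rewrite -[dot _ _](addrK (dot (alQ i) (corootQ X j))) rpredB ?coroot_intQ.
Qed.

Lemma dot_rho i : 2 * dot (rho X n) (alQ i) = dot (alQ i) (alQ i).
Proof.
have -> : rho X n = 2^-1 *: map_mx intr (twice_rho X n).
  by rewrite /rho /twice_rho map_mx_sum.
by rewrite dotZl !dot_intr dot_twice_rho_simple // mulrA mulfV ?mul1r.
Qed.

(** (l + a + rho, l + a + rho) - (l + rho, l + rho) = 2 (l + a, a), because
    2 (rho, a) = (a, a) for a simple root a. *)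
Lemma omega_exp_add l i : omega_exp X (l + del i) =
  omega_exp X l + Dx * dot (weight_vec X (l + del i)) (alQ i).
Proof.
have h := dot_rho i.
have hD : (if X is TypeB then 2 else 1 : rat) = Dx by case: (X).
rewrite /omega_exp hD weight_vec_add.
set w := weight_vec X l; set p := rho X n in h *; set a := alQ i in h *.
rewrite !(dotDl, dotDr) (dotC a w) (dotC p w) (dotC a p) -h; by field.
Qed.

Variables (K : fieldType) (r s : K) (rp sp : rat -> K).
Hypotheses (rpP : rat_power r rp) (spP : rat_power s sp).

Section Power.
Variables (t : K) (tp : rat -> K).
Hypothesis tP : rat_power t tp.

Lemma rat_power0 : tp 0 = 1.
Proof.
apply: (mulfI (rat_power_neq0 tP 0)).
by rewrite -(rat_powerD tP) addr0 mulr1.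
Qed.

Lemma rat_powerN a : tp (- a) = (tp a)^-1.
Proof.
apply: (mulfI (rat_power_neq0 tP a)).
by rewrite -(rat_powerD tP) subrr rat_power0 mulfV ?(rat_power_neq0 tP).
Qed.

Lemma rat_power_nat (m : nat) : tp m%:R = t ^+ m.
Proof.
elim: m => [|m IH]; first by rewrite rat_power0 expr0.
by rewrite -addn1 natrD (rat_powerD tP) IH (rat_power1 tP) exprD.
Qed.

Lemma rat_power_int (z : int) : tp z%:~R = t ^ z.
Proof.
case: z => m; first by rewrite -pmulrn rat_power_nat.
by rewrite NegzE mulrNz rat_powerN -pmulrn rat_power_nat exprnN.
Qed.
End Power.

Lemma brQ_dell l i : brQ X rp sp l (del i) =
  rp (\sum_k (br_exp X k i).1%:~R * l 0 k) * sp (\sum_k (br_exp X k i).2%:~R * l 0 k).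
Proof.
rewrite /brQ; congr (rp _ * sp _); apply: eq_bigr => k _.
  by rewrite (sum_del (fun j => (br_exp X k j).1%:~R * l 0 k)).
by rewrite (sum_del (fun j => (br_exp X k j).2%:~R * l 0 k)).
Qed.

Lemma brQ_delr l i : brQ X rp sp (del i) l =
  rp (\sum_k (br_exp X i k).1%:~R * l 0 k) * sp (\sum_k (br_exp X i k).2%:~R * l 0 k).
Proof.
rewrite /brQ; congr (rp _ * sp _); rewrite exchange_big; apply: eq_bigr => k _.
  under eq_bigr do rewrite mulrAC.
  by rewrite (sum_del (fun j => (br_exp X j k).1%:~R * l 0 k)).
under eq_bigr do rewrite mulrAC.
by rewrite (sum_del (fun j => (br_exp X j k).2%:~R * l 0 k)).
Qed.

Lemma sum_add_del (F : 'I_n -> rat) l i :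
  \sum_k F k * (l + del i) 0 k = F i + \sum_k F k * l 0 k.
Proof.
rewrite -(sum_del F) -big_split; apply: eq_bigr => k _.
by rewrite mxE mulrDr addrC.
Qed.

Lemma brQ_addl l i j :
  brQ X rp sp (l + del i) (del j) = br X r s i j * brQ X rp sp l (del j).
Proof.
rewrite !brQ_dell (sum_add_del (fun k => (br_exp X k j).1%:~R)).
rewrite (sum_add_del (fun k => (br_exp X k j).2%:~R)).
rewrite (rat_powerD rpP) (rat_powerD spP).
by rewrite (rat_power_int rpP) (rat_power_int spP) mulrACA.
Qed.

Lemma brQ_addr l i j :
  brQ X rp sp (del j) (l + del i) = br X r s j i * brQ X rp sp (del j) l.
Proof.
rewrite !brQ_delr (sum_add_del (fun k => (br_exp X j k).1%:~R)).
rewrite (sum_add_del (fun k => (br_exp X j k).2%:~R)).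
rewrite (rat_powerD rpP) (rat_powerD spP).
by rewrite (rat_power_int rpP) (rat_power_int spP) mulrACA.
Qed.

Lemma brQ_sym l i : brQ X rp sp l (del i) * brQ X rp sp (del i) l =
  rp (Dx * dot (weight_vec X l) (alQ i)) * sp (- (Dx * dot (weight_vec X l) (alQ i))).
Proof.
rewrite brQ_dell brQ_delr mulrACA -(rat_powerD rpP) -(rat_powerD spP) -!big_split /=.
have E : Dx * dot (weight_vec X l) (alQ i) =
   \sum_k Dx * (dot (al k) (al i))%:~R * l 0 k.
  rewrite /weight_vec dot_suml mulr_sumr; apply: eq_bigr => k _.
  by rewrite dotZl dot_intr mulrCA mulrC.
rewrite E -sumrN; congr (rp _ * sp _); apply: eq_bigr => k _;
  have [h1 h2] := br_exp_sym simp k i.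
  by rewrite -mulrDl -intrD h1 intrM.
by rewrite -mulrDl -intrD h2 mulrNz intrM mulNr.
Qed.

Definition theta (l : wt) := rp (omega_exp X l) * sp (- omega_exp X l).

Lemma theta_add l i : theta (l + del i) = theta l *
  (brQ X rp sp (l + del i) (del i) / (brQ X rp sp (del i) (l + del i))^-1).
Proof.
rewrite invrK brQ_sym /theta mulrACA -(rat_powerD rpP) -(rat_powerD spP).
by rewrite omega_exp_add opprD.
Qed.

Lemma brQ_neq0 (l l' : wt) : brQ X rp sp l l' != 0.
Proof. by rewrite mulf_neq0 ?(rat_power_neq0 rpP) ?(rat_power_neq0 spP). Qed.

Lemma weight_data_theta : weight_data (br X r s) (@in_Lambda X n)
  (fun l i => brQ X rp sp l (del i)) (fun l i => (brQ X rp sp (del i) l)^-1) theta.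
Proof.
split=> [l i|l i|l i j|l i j|l i|l i].
- exact: in_Lambda_add.
- exact: in_Lambda_sub.
- exact: brQ_addl.
- by rewrite brQ_addr invfM.
- by rewrite invr_eq0 brQ_neq0.
- exact: theta_add.
Qed.

End Weights.

(** * The quantum group and its modules *)

Section SideRelOfConj.
Variables (K : fieldType) (n : nat) (A : algType K) (x : gen n -> A).
Variables (q : 'I_n -> 'I_n -> K) (c : 'I_n -> K).

Lemma twisted_comm_of_conj (k ki y : A) (a : K) : ki * k = 1 ->
  k * y * ki = a *: y -> k * y = a *: (y * k).
Proof.
by move=> Kk h; rewrite scalerAl -h -(mulrA _ ki) Kk mulr1.
Qed.

Lemma side_rel_of_conj :
  (forall i j, q i j != 0) ->
  (forall b i, x (tgen b i) * x (tinv b i) = 1) ->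
  (forall g h, toral g -> toral h -> x g * x h = x h * x g) ->
  (forall b i j, x (tgen b i) * x (rgen b j) * x (tinv b i) =
     side_br q b i j *: x (rgen b j)) ->
  (forall b i j, x (tgen (~~ b) i) * x (rgen b j) * x (tinv (~~ b) i) =
     (side_br q b j i)^-1 *: x (rgen b j)) ->
  (forall k l, x (Ge k) * x (Gf l) - x (Gf l) * x (Ge k) =
     (k == l)%:R *: (c k *: (x (Gw k) - x (Gw' k)))) ->
  side_rel x q c.
Proof.
move=> q0 kK tor kg gk ef.
have tinvK b i : x (tinv b i) * x (tgen b i) = 1 by rewrite tor ?kK //; case: b.
split=> // b i j.
- by apply: twisted_comm_of_conj; [exact: tinvK|exact: kg].
- rewrite (twisted_comm_of_conj (tinvK _ _) (gk b i j)) scalerA mulfV ?scale1r //.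
  by case: (b); exact: q0.
case: b => /=; last by rewrite ef eq_sym.
rewrite -opprB ef -[x (Gw' i) - _]opprB.
by case: eqP => [->|]; rewrite ?scale0r ?oppr0 // !scalerN.
Qed.

End SideRelOfConj.

Section QuantumGroup.
Variables (K : fieldType) (X : lie_type) (n : nat) (r s : K).
Hypotheses (r0 : r != 0) (s0 : s != 0).
Local Notation U := (Urs X n r s).
Local Notation UR := (Urel X r s (@free_gen K n)).
Local Notation x := (@Ugen K X n r s).
Local Notation br := (br X r s).

Definition rs_coef (i : 'I_n) : K := (r_ X r i - s_ X s i)^-1.

Lemma to_quotD (a b : {malg K[{fmonom gen n}]}) :
  to_quot UR (a + b) = to_quot UR a + to_quot UR b :> U.
Proof. by rewrite -quot_addE. Qed.
Lemma to_quotN (a : {malg K[{fmonom gen n}]}) :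
  to_quot UR (- a) = - to_quot UR a :> U.
Proof. by rewrite -quot_oppE. Qed.
Lemma to_quotM (a b : {malg K[{fmonom gen n}]}) :
  to_quot UR (a * b) = to_quot UR a * to_quot UR b :> U.
Proof. by rewrite -quot_mulE. Qed.
Lemma to_quotZ (c : K) (a : {malg K[{fmonom gen n}]}) :
  to_quot UR (c *: a) = c *: to_quot UR a :> U.
Proof. by rewrite -quot_scaleE. Qed.

Lemma to_quot_rel a b : UR a b -> to_quot UR a = to_quot UR b :> U.
Proof. by move=> h; apply: to_quot_eq; apply: rel_ideal_rel. Qed.

Lemma to_quot_mon (w : seq (gen n)) : to_quot UR << FMonom w >> = Umon X r s w :> U.
Proof.
rewrite /Umon /mon; elim: w => [|g w IH].
  rewrite big_nil; apply: (congr1 (fun m => to_quot UR << m >>)).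
  by apply/val_inj; rewrite /= fm1.
rewrite big_cons -IH /Ugen -to_quotM; congr (to_quot _ _).
rewrite malgM_def fgmulUU mulr1; congr << _ >>; apply/val_inj.
by rewrite /= fmM.
Qed.

Lemma Urs_span (a : U) : word_span x predT a.
Proof.
rewrite -(to_quot_repr a); move: (repr a) => b; rewrite [b]monalgE.
elim: (enum_fset _) => [|m t IH]; first by rewrite big_nil; exact: (word_span0 x).
rewrite big_cons to_quotD; apply: (word_spanD (x := x)) => //.
have -> : << b@_m *g m >> = b@_m *: << m >> :> {malg K[_]}.
  by apply/malgP => k; rewrite mcoeffZ !mcoeffU mulr_natr.
rewrite to_quotZ; apply: (word_spanZ (x := x)).
by case: m => m; rewrite to_quot_mon; exact: (word_span_mon x).
Qed.

Lemma br_neq0 (i j : 'I_n) : br i j != 0.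
Proof. by rewrite mulf_neq0 // expfz_neq0. Qed.

Lemma Ugen2 g h : to_quot UR (free_gen K g * free_gen K h) = x g * x h.
Proof. exact: to_quotM. Qed.

Lemma Ugen3 g h k :
  to_quot UR (free_gen K g * free_gen K h * free_gen K k) = x g * x h * x k.
Proof. exact: etrans (to_quotM _ _) (congr1 (fun y => y * x k) (to_quotM _ _)). Qed.

Lemma Ugen_tgenK b i : x (tgen b i) * x (tinv b i) = 1.
Proof.
apply: etrans (esym (Ugen2 _ _)) _; apply: (@to_quot_rel _ 1).
by case: b; constructor.
Qed.

Lemma Ugen_toral g h : toral g -> toral h -> x g * x h = x h * x g.
Proof.
move=> tg th; apply: etrans (esym (Ugen2 _ _)) _; apply: etrans _ (Ugen2 _ _).
by apply: to_quot_rel; constructor.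
Qed.

Lemma Ugen_conj g h k (a : K) :
  UR (free_gen K g * free_gen K h * free_gen K k) (a *: free_gen K h) ->
  x g * x h * x k = a *: x h.
Proof.
move=> R; apply: etrans (esym (Ugen3 _ _ _)) _; apply: etrans _ (to_quotZ _ _).
exact: to_quot_rel.
Qed.

Lemma Ugen_ef k l : x (Ge k) * x (Gf l) - x (Gf l) * x (Ge k) =
   (k == l)%:R *: (rs_coef k *: (x (Gw k) - x (Gw' k))).
Proof.
have E : to_quot UR ((k == l)%:R *:
    (rs_coef k *: (free_gen K (Gw k) - free_gen K (Gw' k))))
  = (k == l)%:R *: (rs_coef k *: (x (Gw k) - x (Gw' k))).
  by rewrite !to_quotZ to_quotD to_quotN.
have E1 := etrans (to_quotD (free_gen K (Ge k) * free_gen K (Gf l)) _)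
  (congr2 (fun y z : U => y + z) (Ugen2 _ _)
    (etrans (to_quotN (free_gen K (Gf l) * free_gen K (Ge k)))
      (congr1 (fun y : U => - y) (Ugen2 _ _)))).
apply: etrans (esym E1) (etrans _ E).
by apply: to_quot_rel; constructor.
Qed.

Lemma Urs_side_rel : side_rel x br rs_coef.
Proof.
apply: side_rel_of_conj.
- exact: br_neq0.
- exact: Ugen_tgenK.
- exact: Ugen_toral.
- by move=> b i j; apply: Ugen_conj; case: b; constructor.
- by move=> b i j; apply: Ugen_conj; case: b; constructor.
- exact: Ugen_ef.
Qed.

End QuantumGroup.

Section LocalFiniteness.
Variables (K : fieldType) (n : nat) (A : algType K) (x : gen n -> A).
Variables (q : 'I_n -> 'I_n -> K) (c : 'I_n -> K).
Hypothesis rel : side_rel x q c.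
Variable M : lmodType A.
Local Notation wt := 'rV[rat]_n.
Local Notation del i := (delta_mx 0 i : wt).
Variables (Lam : wt -> Prop) (chi chi' : wt -> 'I_n -> K) (eig : wt -> K).
Hypothesis WD : weight_data q Lam chi chi' eig.
Local Notation weight_vector := (@weight_vector K n A x M chi chi').

Hypothesis wt_sum : forall m : M, exists2 t : seq (wt * M),
  {in t, forall p, Lam p.1 /\ weight_vector p.1 p.2} & m = \sum_(p <- t) p.2.
Hypothesis wt_bounded : exists2 F : seq wt, {in F, forall mu, Lam mu} &
  forall l, Lam l -> (exists2 m, weight_vector l m & m != 0) ->
    exists2 mu, mu \in F & exists z : Qplus n, l = weight_sub mu z.

Definition degree_box (k : nat) : {fset Qplus n} :=
  [fset z in [seq [ffun i => (f i : nat)] | f : {ffun 'I_n -> 'I_k.+1}]]%fset.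

Lemma notin_degree_box k z : z \notin degree_box k -> exists i, (k < z i)%N.
Proof.
move=> zk; apply/existsP; apply: contraR zk; rewrite negb_exists => /forallP h.
rewrite /degree_box inE /=; apply/mapP.
have hz i : (z i < k.+1)%N by rewrite ltnS leqNgt; exact: h.
exists [ffun i => Ordinal (hz i)]; first by rewrite mem_enum.
by apply/ffunP => i; rewrite !ffunE.
Qed.

Lemma weight_vector_eword w l m : Lam l -> weight_vector l m ->
  let l' := l + \sum_(j <- w) del j in
  Lam l' /\ weight_vector l' (mon x (map (rgen true) w) *: m).
Proof.
move=> Ll lm; elim: w => [|j w [IH1 IH2]] /=.
  by rewrite big_nil addr0 mon_nil scale1r.
rewrite big_cons (addrC (del j)) addrA mon_cons -scalerA; split.
  exact: (Lam_add WD).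
exact: (weight_vector_e rel WD).
Qed.

(** If a word of degree z does not kill a vector of weight l, then l + z is below
    one of the finitely many maximal weights, which bounds every coordinate
    of z. *)
Lemma locally_finiteP : locally_finite x M.
Proof.
have [F FL FP] := wt_bounded.
move=> m; have [t tP ->] := wt_sum m.
elim: t tP => [_|[l m'] t IH tP].
  by exists fset0 => z y _ _; rewrite big_nil scaler0.
have {IH}[|D DP] := IH; first by move=> p pt; apply: tP; rewrite inE pt orbT.
have [Ll lm] := tP _ (mem_head _ _); rewrite /= in Ll lm.
pose k := (\max_(mu <- F) \max_(i < n) Num.bound (`|mu 0 i - l 0 i|)%R)%N.
exists (D `|` degree_box k)%fset => z y; rewrite inE negb_or => /andP[zD zk] Sy.
rewrite big_cons scalerDr (DP _ _ zD Sy) addr0 /= => {DP zD tP t D m}.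
have [i zi] := notin_degree_box zk.
elim/word_span_ind: Sy => [|a y1 y2 _ h1 _ h2|w sw].
- by rewrite scale0r.
- by rewrite scalerDl h2 addr0 -mulr_algl -scalerA h1 scaler0.
move: (sw); rewrite deg_wordE => /andP[/is_rgen_map[w' def_w] _].
rewrite {w}def_w in sw *; apply/eqP/negPn/negP => nz.
have [L' W'] := weight_vector_eword w' Ll lm.
have [mu muF [z' E]] := FP _ L' (ex_intro2 _ _ _ W' nz).
have wi : (\sum_(j <- w') del j) 0 i = (z i)%:R.
  move: sw; rewrite deg_wordE => /andP[_ /forallP /(_ i) /eqP <-].
  rewrite summxE count_map; elim: w' {L' W' E nz} => [|j w' IH]; first by rewrite big_nil.
  rewrite big_cons IH /= natrD mxE eqxx /= (inj_eq (@rgen_inj _ true)) eq_sym.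
  by [].
have {E} := congr1 (fun v : wt => v 0 i) E; rewrite /weight_sub !mxE wi => E.
have zle : ((z i)%:R : rat) <= `|mu 0 i - l 0 i|.
  apply: le_trans (ler_norm _); rewrite -subr_ge0.
  have -> : mu 0 i - l 0 i - (z i)%:R = (z' i)%:R by lra.
  exact: ler0n.
have := le_lt_trans zle (archi_boundP (normr_ge0 _)); rewrite ltr_nat => zb.
have : (Num.bound (`|mu 0 i - l 0 i|)%R <= k)%N.
  apply: (leq_trans _ (leq_bigmax_seq mu muF isT)).
  exact: (leq_bigmax (F := fun i : 'I_n => Num.bound (`|mu 0 i - l 0 i|)%R)).
by move=> /(leq_trans zb); rewrite ltnNge (ltnW zi).
Qed.

End LocalFiniteness.

Section PairingSides.
Variables (K : fieldType) (X : lie_type) (n : nat) (r s : K).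
Local Notation U := (Urs X n r s).
Local Notation x := (@Ugen K X n r s).
Local Notation br := (br X r s).
Variable p : U -> U -> K.
Hypothesis pP : is_pairing p.

Definition side_pi (b : bool) (a a' : U) : K := if b then p a' a else p a a'.

Lemma rs_coef_opp (i : 'I_n) : (s_ X s i - r_ X r i)^-1 = - rs_coef X r s i.
Proof. by rewrite /rs_coef -invrN opprB. Qed.

Lemma side_pairingP : side_pairing x br (rs_coef X r s) side_pi.
Proof.
split.
- by case.
- case=> k a1 a2 a' h1 h2 h'; rewrite /side_pi.
    exact: (pairing_linearr pP).
  exact: (pairing_linearl pP).
- case=> w lw; rewrite /side_pi; [exact: (pairing1l pP)|exact: (pairing1r pP)].
- case=> w a1 a2 lw h1 h2; rewrite /side_pi; first exact: (pairingMl pP).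
  rewrite /side_coprod big_map; exact: (pairingMr pP).
- case=> i j; rewrite /side_pi (pairing_gen pP) //= rs_coef_opp mulrC.
    by rewrite eq_sym.
  by case: eqP => [->|_]; rewrite ?mulr0.
- by case=> i j; rewrite /side_pi (pairing_gen pP).
- by case=> i j; rewrite /side_pi (pairing_gen pP).
Qed.

End PairingSides.

Theorem theorem3p13 (K : closedFieldType) (X : lie_type) (n : nat) (r s : K)
    (charK : [pchar K] =i pred0) (r_neq0 : r != 0) (s_neq0 : s != 0)
    (rs_neq : r ^+ 2 != s ^+ 2) (g_simple : is_simple X n)
    (rs_nroot : forall k : nat, (0 < k)%N -> (r / s) ^+ k != 1)
    (rp sp : rat -> K) (rpP : rat_power r rp) (spP : rat_power s sp)
    (S : Urs X n r s -> Urs X n r s) (SP : is_antipode S)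
    (p : Urs X n r s -> Urs X n r s -> K) (pP : is_pairing p)
    (d : Qplus n -> nat) (u v : forall z : Qplus n, 'I_(d z) -> Urs X n r s)
    (uvP : forall z : Qplus n, dual_bases p z (u z) (v z))
    (M : lmodType (Urs X n r s)) (MO : in_O rp sp M)
    (om : M -> M) (omP : is_omega rp sp om) :
  forall (a : Urs X n r s) (m : M),
    casimir S u v (om (a *: m)) = a *: casimir S u v (om m).
Proof.
have rel := Urs_side_rel X n r_neq0 s_neq0.
have SP' : alg_antipode (@Ugen K X n r s) S.
  by split; [exact: (antipode_linear SP)|exact: (antipodeM SP)|exact: (antipodeE SP)].
have uvP' : alg_dual_bases (@Ugen K X n r s) (side_pi p) u v.
  split=> [z l|z l|z a|z a|z j k]; have [[u1 u2 _] [v1 v2 _] uv] := uvP z.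
  - exact: u1.
  - exact: v1.
  - exact: u2.
  - exact: v2.
  - exact: uv.
have WD := weight_data_theta g_simple rpP spP.
have fin := locally_finiteP rel WD (O_sum MO) (O_bounded MO).
exact: (casimir_omega_commutes rel (side_pairingP pP) SP' uvP' fin WD
  (omega_linear omP) (omega_weight omP) (O_sum MO) (@Urs_span _ _ _ _ _)).
Qed.
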